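(* Let $(L_s)_{s\in\mathbb{R}}$ be a two-sided real-valued Lévy process with mean zero, finite variance, and $\mathrm{Var}(L_1)=1$. Let $(f_n)_{n\ge1}$ be a sequence of real-valued functions in $L^2(\mathbb{R})$ such that $$\int_{-\infty}^\infty f_n^2(s)\,ds\to1\qquad\text{as }n\to\infty,$$ and such that for each $\eta>0$ $$\int_{\{s:\,|f_n(s)|>\eta\}}f_n^2(s)\,ds\to0\qquad\text{as }n\to\infty.$$ Then $$\int_{-\infty}^\infty f_n(s)\,dL_s\overset{d}{\longrightarrow}\mathcal{N}(0,1)\qquad\text{as }n\to\infty.$$
   Context: A two-sided Lévy process $(L_s)_{s\in\mathbb{R}}$ has $L_0=0$, independent and stationary increments and càdlàg paths. For deterministic $f\in L^2(\mathbb{R})$, $\int_{-\infty}^\infty f(s)\,dL_s$ is the $L^2$ stochastic integral, which satisfies $\mathbb{E}\left[\left(\int f\,dL\right)^2\right]=\int f^2(s)\,ds$. $\overset{d}{\longrightarrow}$ denotes convergence in distribution. *)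

(* Defs.v *)
From HB Require Import structures.
From mathcomp Require Import all_boot all_order all_algebra.
From mathcomp Require Import all_classical all_reals all_analysis.

Set Implicit Arguments.
Unset Strict Implicit.
Unset Printing Implicit Defensive.

Import Order.TTheory GRing.Theory Num.Theory.
Import numFieldNormedType.Exports.

Local Open Scope classical_set_scope.
Local Open Scope ring_scope.

(* Subfamilies are covered by taking [B i = setT] for the omitted indices. *)
Definition mutually_independent (d : measure_display) (T : measurableType d)
    (R : realType) (P : probability T R) (I : finType)
    (X : I -> T -> R) : Prop :=
  forall B : I -> set R, (forall i, measurable (B i)) ->
    P (\bigcap_i (X i @^-1` B i)) = (\prod_(i : I) P (X i @^-1` B i))%E.

(* Not stated as [distribution P X = distribution P Y]: the values of these
   set functions on nonmeasurable sets carry no meaning. *)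
Definition identically_distributed (d : measure_display) (T : measurableType d)
    (R : realType) (P : probability T R) (X Y : T -> R) : Prop :=
  forall B : set R, measurable B -> P (X @^-1` B) = P (Y @^-1` B).

Definition cadlag (R : realType) (x : R -> R) : Prop :=
  forall t : R, x s @[s --> t^'+] --> x t /\ cvg (x s @[s --> t^'-]).

(* Two-sided: the index set is the whole line. As usual for processes, the
   normalization at 0 and the path regularity are only required almost
   surely. *)
Record levy_process (d : measure_display) (T : measurableType d)
    (R : realType) (P : probability T R) (L : R -> {RV P >-> R}) : Prop :=
  LevyProcess {
    levy_at0 : {ae P, forall w, L 0 w = 0} ;
    levy_independent : forall (n : nat) (t : nat -> R), nondecreasing_seq t ->
      mutually_independent P (fun i : 'I_n => L (t i.+1) \- L (t i)) ;
    levy_stationary : forall s t h : R, s <= t ->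
      identically_distributed P (L (t + h) \- L (s + h)) (L t \- L s) ;
    levy_cadlag : {ae P, forall w, cadlag (fun s => L s w)} }.

Definition step_fun (R : realType) (n : nat) (t c : nat -> R) : R -> R :=
  fun s => \sum_(i < n) c i * \1_(`]t i, t i.+1]%classic) s.

Definition step_integral (d : measure_display) (T : measurableType d)
    (R : realType) (P : probability T R) (L : R -> {RV P >-> R}) (n : nat)
    (t c : nat -> R) : T -> R :=
  fun w => \sum_(i < n) c i * (L (t i.+1) w - L (t i) w).

(* [X] is a version of the L^2 integral of the deterministic function [f]
   against [L], i.e. of the value at [f] of the continuous extension to
   L^2(R) of the map [step_fun n t c |-> step_integral L n t c]. The
   integral is only defined up to almost sure equality, hence a predicate. *)
Definition is_stoch_integral (d : measure_display) (T : measurableType d)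
    (R : realType) (P : probability T R) (L : R -> {RV P >-> R})
    (f : R -> R) (X : {RV P >-> R}) : Prop :=
  exists (m : nat -> nat) (t c : nat -> nat -> R),
    [/\ forall k, nondecreasing_seq (t k),
        (\int[lebesgue_measure]_s
           ((f s - step_fun (m k) (t k) (c k) s) ^+ 2)%:E)%E
          @[k --> \oo] --> 0%E
      & (\int[P]_w ((X w - step_integral L (m k) (t k) (c k) w) ^+ 2)%:E)%E
          @[k --> \oo] --> 0%E].

Definition cvg_in_distribution (d : measure_display) (T : measurableType d)
    (R : realType) (P : probability T R) (X : nat -> {RV P >-> R})
    (mu : probability (measurableTypeR R) R) : Prop :=
  forall g : R -> R, continuous g -> (exists M : R, forall x, `|g x| <= M) ->
    ('E_P[g \o X n])%E @[n --> \oo] --> (\int[mu]_x (g x)%:E)%E.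

(* Main.v *)
Require Import Defs.
From HB Require Import structures.
From mathcomp Require Import all_boot all_order all_algebra.
From mathcomp Require Import all_classical all_reals all_analysis.
From mathcomp Require Import measurable_realfun.
From mathcomp Require Import ring lra.

(* Stein's method. By the isometry, X n is L^2-close to the integral W of a step
   function with coefficients bounded by eta, for any eta > 0, on a partition that
   may be refined at will; W is thus a sum of independent centered terms. Expanding
   around leave-one-out sums gives E[W k(W)] ~ E[W ^+ 2] E[k'(W)] for test functions
   k, with Lindeberg's error term. The latter is small because
   E[D ^+ 2; |D| > K] <= 8 (t - s) E[D01 ^+ 2; |D01| > K / 4] for D = L t - L s with
   t - s <= 1 and D01 = L 1 - L 0, which follows from independence alone.
   For g bounded and continuous with Gaussian mean c, the bounded solution h of
   h' - x h = g - c multiplied by 1 / (1 + b ^+ 2 x ^+ 2) is an admissible k, and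
   k' - x k differs from g - c by O(b + b ^+ 2 x ^+ 2). *)

(** Admissible means that [k] is bounded while k' and k' - x k are bounded and uniformly continuous:
    the first modulus makes Lindeberg's remainder small, the second moves the estimate from W to
    [X n], which are only close in L^2. The solution h itself need not qualify. As g is merely
    bounded and continuous, h' = x h + g - c may fail to be uniformly continuous, and boundedness of
    h alone leaves room for linear growth of x h; hence the damping at infinity. The other obstacle
    is that increments over short intervals are not rescaled copies of one variable, so Lindeberg's
    condition for W needs a bound on E[D ^+ 2; |D| > K] / (t - s) that is uniform as t - s tends to
    0. Small coefficients then suffice: if |c| <= eta and K eta <= e, a summand c D exceeds e in
    absolute value only where |D| > K. Clipping at eta provides such coefficients, and what it
    removes is controlled by the mass of f_n where |f_n| > eta. *)

Set Implicit Arguments.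
Unset Strict Implicit.
Unset Printing Implicit Defensive.

Import Order.TTheory GRing.Theory Num.Theory.
Import numFieldNormedType.Exports.

Local Open Scope classical_set_scope.
Local Open Scope ring_scope.

(** * Real-valued expectation *)

Section RealExpectation.
Context (d : measure_display) (T : measurableType d) (R : realType).
Variable P : probability T R.
Implicit Types (U V : T -> R).

Definition intble U := P.-integrable setT (EFin \o U).
Definition Ex U : R := \int[P]_w U w.

Lemma intble_measurable U : intble U -> measurable_fun setT U.
Proof. by move=> /measurable_int /measurable_EFinP. Qed.

Lemma intble_le U V : measurable_fun setT U -> (forall w, `|U w| <= V w) ->
  intble V -> intble U.
Proof.
move=> mU UV; apply: le_integrable => //; first exact/measurable_EFinP.
by move=> w _ /=; rewrite lee_fin (le_trans (UV w))// ler_norm.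
Qed.

Lemma eq_intble U V : (forall w, U w = V w) -> intble U -> intble V.
Proof. by move=> /funext ->. Qed.

Lemma intble_cst (c : R) : intble (fun=> c).
Proof. exact: finite_measure_integrable_cst. Qed.

Lemma intble_bounded U (c : R) : measurable_fun setT U ->
  (forall w, `|U w| <= c) -> intble U.
Proof. by move=> mU Uc; apply: intble_le (intble_cst c). Qed.

Lemma intbleD U V : intble U -> intble V -> intble (fun w => U w + V w).
Proof. by move=> iU iV; exact: integrableD iU iV. Qed.

Lemma intbleN U : intble U -> intble (fun w => - U w).
Proof. by move=> iU; exact: integrableN iU. Qed.

Lemma intbleB U V : intble U -> intble V -> intble (fun w => U w - V w).
Proof. by move=> iU iV; apply: intbleD iU (intbleN iV). Qed.

Lemma intbleZ (c : R) U : intble U -> intble (fun w => c * U w).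
Proof. by move=> iU; exact: integrableZl iU. Qed.

Lemma intble_norm U : intble U -> intble (fun w => `|U w|).
Proof. exact: integrable_norm. Qed.

Lemma intble_sum (I : Type) (s : seq I) (A : pred I) (U : I -> T -> R) :
  (forall i, A i -> intble (U i)) -> intble (fun w => \sum_(i <- s | A i) U i w).
Proof.
move=> iU; elim: s => [|i s IH].
  by apply: (eq_intble _ (intble_cst 0)) => w; rewrite big_nil.
have [Ai|nAi] := boolP (A i).
  by apply: (eq_intble _ (intbleD (iU _ Ai) IH)) => w; rewrite big_cons Ai.
by apply: (eq_intble _ IH) => w; rewrite big_cons (negbTE nAi).
Qed.

Lemma eq_Ex U V : (forall w, U w = V w) -> Ex U = Ex V.
Proof. by move=> UV; congr Ex; exact/funext. Qed.

Lemma Ex_cst (c : R) : Ex (fun=> c) = c.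
Proof. by rewrite /Ex Rintegral_cst//= probability_setT mulr1. Qed.

Lemma ExD U V : intble U -> intble V -> Ex (fun w => U w + V w) = Ex U + Ex V.
Proof. by move=> iU iV; exact: RintegralD. Qed.

Lemma ExZ (c : R) U : intble U -> Ex (fun w => c * U w) = c * Ex U.
Proof. by move=> iU; exact: RintegralZl. Qed.

Lemma ExB U V : intble U -> intble V -> Ex (fun w => U w - V w) = Ex U - Ex V.
Proof. by move=> iU iV; exact: RintegralB. Qed.

Lemma Ex_sum (I : Type) (s : seq I) (A : pred I) (U : I -> T -> R) :
  (forall i, A i -> intble (U i)) ->
  Ex (fun w => \sum_(i <- s | A i) U i w) = \sum_(i <- s | A i) Ex (U i).
Proof.
move=> iU; elim: s => [|i s IH].
  by rewrite big_nil -[RHS]Ex_cst; apply: eq_Ex => w; rewrite big_nil.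
have [Ai|nAi] := boolP (A i); rewrite big_cons ?Ai ?(negbTE nAi) -IH.
  rewrite -ExD; [|exact: iU|exact: intble_sum].
  by apply: eq_Ex => w; rewrite big_cons Ai.
by apply: eq_Ex => w; rewrite big_cons (negbTE nAi).
Qed.

Lemma Ex_le U V : intble U -> intble V -> (forall w, U w <= V w) ->
  Ex U <= Ex V.
Proof. by move=> iU iV UV; apply: le_Rintegral. Qed.

Lemma Ex_ge0 U : (forall w, 0 <= U w) -> 0 <= Ex U.
Proof. by move=> U0; apply: Rintegral_ge0. Qed.

Lemma normr_Ex U : intble U -> `|Ex U| <= Ex (fun w => `|U w|).
Proof. by move=> iU; exact: le_normr_Rintegral. Qed.

Lemma normr_Ex_le U V : measurable_fun setT U -> intble V ->
  (forall w, `|U w| <= V w) -> `|Ex U| <= Ex V.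
Proof.
move=> mU iV UV; have iU := intble_le mU UV iV.
by apply: le_trans (normr_Ex iU) _; apply: Ex_le => //; exact: intble_norm.
Qed.

Lemma EFin_Ex U : intble U -> (\int[P]_w (U w)%:E)%E = (Ex U)%:E.
Proof. by move=> iU; rewrite /Ex /Rintegral fineK//; exact: integrable_fin_num. Qed.

(** Measurability is asked of [U] itself, since it does not follow from that of its square. *)
Definition sqintble U := measurable_fun setT U /\ intble (fun w => U w ^+ 2).

Lemma eq_sqintble U V : (forall w, U w = V w) -> sqintble U -> sqintble V.
Proof. by move=> /funext ->. Qed.

Lemma sqintbleM U V : sqintble U -> sqintble V -> intble (fun w => U w * V w).
Proof.
move=> [mU iU] [mV iV]; apply: intble_le (intbleD iU iV).
  exact: measurable_funM.
move=> w; rewrite ler_norml; apply/andP; split; nra.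
Qed.

Lemma sqintble_bounded U (c : R) : measurable_fun setT U ->
  (forall w, `|U w| <= c) -> sqintble U.
Proof.
move=> mU Uc; split=> //; apply: (@intble_bounded _ (c ^+ 2)).
  exact: measurable_funX.
by move=> w; rewrite normrX lerXn2r ?nnegrE// (le_trans _ (Uc w)).
Qed.

Lemma sqintble_intble U : sqintble U -> intble U.
Proof.
move=> sU; have s1 : sqintble (fun=> 1).
  by apply: (@sqintble_bounded _ 1) => // w; rewrite normr1.
by apply: eq_intble (sqintbleM sU s1) => w; rewrite mulr1.
Qed.

Lemma sqintbleZ (c : R) U : sqintble U -> sqintble (fun w => c * U w).
Proof.
move=> [mU iU]; split; first exact: measurable_funM.
by apply: eq_intble (intbleZ (c ^+ 2) iU) => w; rewrite exprMn.
Qed.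

Lemma sqintbleD U V : sqintble U -> sqintble V -> sqintble (fun w => U w + V w).
Proof.
move=> sU sV; split; first by apply: measurable_funD; [case: sU|case: sV].
apply: (@eq_intble (fun w => U w ^+ 2 + 2 * (U w * V w) + V w ^+ 2)).
  by move=> w; ring.
apply: intbleD; last by case: sV.
by apply: intbleD; [case: sU|exact/intbleZ/sqintbleM].
Qed.

Lemma sqintbleB U V : sqintble U -> sqintble V -> sqintble (fun w => U w - V w).
Proof.
move=> sU sV; apply: eq_sqintble (sqintbleD sU (sqintbleZ (-1) sV)) => w.
by rewrite mulN1r.
Qed.

Lemma sqintble_sum (I : Type) (s : seq I) (A : pred I) (U : I -> T -> R) :
  (forall i, A i -> sqintble (U i)) ->
  sqintble (fun w => \sum_(i <- s | A i) U i w).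
Proof.
move=> iU; elim: s => [|i s IH].
  apply: (@sqintble_bounded _ 0) => [|w]; last by rewrite big_nil normr0.
  by rewrite (_ : (fun _ => _) = fun=> 0)//; apply/funext => w; rewrite big_nil.
have [Ai|nAi] := boolP (A i).
  by apply: (eq_sqintble _ (sqintbleD (iU _ Ai) IH)) => w; rewrite big_cons Ai.
by apply: (eq_sqintble _ IH) => w; rewrite big_cons (negbTE nAi).
Qed.

Lemma sqintble_le U V : measurable_fun setT U -> (forall w, `|U w| <= `|V w|) ->
  sqintble V -> sqintble U.
Proof.
move=> mU UV [mV iV]; split => //; apply: intble_le iV.
  exact: measurable_funX.
by move=> w; rewrite normrX -[leRHS]real_normK ?num_real// lerXn2r ?nnegrE.
Qed.

End RealExpectation.

(** * Independence *)

Section Independence.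
Context (d : measure_display) (T : measurableType d) (R : realType).
Variable P : probability T R.
Implicit Types (U V : T -> R).

Definition independent U V := forall A B : set R, measurable A -> measurable B ->
  P (U @^-1` A `&` V @^-1` B) = (P (U @^-1` A) * P (V @^-1` B))%E.

Lemma measurable_preimage U (A : set R) : measurable_fun setT U -> measurable A ->
  measurable (U @^-1` A).
Proof. by move=> mU mA; rewrite -[_ @^-1` _]setTI; exact: mU. Qed.

Lemma independent_comp U V (u v : R -> R) : measurable_fun setT u ->
  measurable_fun setT v -> independent U V ->
  independent (fun w => u (U w)) (fun w => v (V w)).
Proof.
move=> mu mv UV A B mA mB.
by apply: (UV (u @^-1` A) (v @^-1` B)); rewrite -[_ @^-1` _]setTI; [exact: mu|exact: mv].
Qed.

(** By independence the joint law of [U] and [V] agrees with the product of the marginals on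
    rectangles, hence on all measurable sets; Fubini's theorem then factors the integral of the
    product of the coordinates. *)
Lemma independent_ExM U V : intble P U -> intble P V -> independent U V ->
  intble P (fun w => U w * V w) /\ Ex P (fun w => U w * V w) = Ex P U * Ex P V.
Proof.
move=> iU iV UV.
have mU := intble_measurable iU; have mV := intble_measurable iV.
pose X : {RV P >-> R} := HB.pack U (isMeasurableFun.Build _ _ _ _ U mU).
pose Y : {RV P >-> R} := HB.pack V (isMeasurableFun.Build _ _ _ _ V mV).
have mUV : measurable_fun setT (fun w => (U w, V w)) by exact: measurable_fun_pair.
pose Z : {mfun T >-> (R * R)%type} :=
  HB.pack (fun w => (U w, V w)) (isMeasurableFun.Build _ _ _ _ _ mUV).
have prodE (A : set (R * R)) : measurable A ->
    (distribution P X \x distribution P Y)%E A = distribution P Z A.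
  apply: product_measure_unique => A1 A2 mA1 mA2.
  by rewrite /distribution /pushforward /= -UV.
pose f (z : R * R) := (z.1 * z.2)%:E.
have mf : measurable_fun setT f.
  by apply/measurable_EFinP; apply: measurable_funM.
have intf : ((distribution P X \x distribution P Y)%E).-integrable setT f.
  apply/integrable12ltyP => //=.
  rewrite (@eq_integral _ _ _ _ _ (fun x : R => (Ex P (fun w => `|V w|) * `|x|)%:E)).
    rewrite (ge0_integral_distribution X)//=; last first.
      by move=> y; rewrite lee_fin mulr_ge0//; exact: Ex_ge0.
      by apply/measurable_EFinP; apply: measurable_funM => //; exact: measurableT_comp.
    rewrite EFin_Ex ?ltry//; exact/intbleZ/intble_norm.
  move=> x _; under eq_integral do rewrite normrM.
  rewrite (ge0_integral_distribution Y (f := fun y => (`|x| * `|y|)%:E))//=.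
    rewrite (EFin_Ex (U := fun w => `|x| * `|V w|)); last exact/intbleZ/intble_norm.
    by rewrite ExZ 1?mulrC//; exact/intble_norm.
  by apply/measurable_EFinP; apply: measurable_funM => //; exact: measurableT_comp.
have iUV : intble P (fun w => U w * V w).
  have : P.-integrable setT (f \o Z).
    apply/integrableP; split; first exact: measurableT_comp.
    rewrite -(ge0_integral_distribution Z (f := fun z => (`|f z|)%E))//; last first.
      exact: measurableT_comp.
    rewrite (eq_measure_integral (distribution P X \x distribution P Y)%E).
      by case/integrableP : intf.
    by move=> A mA _; exact/esym/prodE.
  by [].
split => //; apply: EFin_inj; rewrite -EFin_Ex//.
rewrite -[LHS]/(\int[P]_w (f \o Z) w)%E -(integral_distribution (X := Z) (f := f))//.
rewrite (eq_measure_integral (distribution P X \x distribution P Y)%E); last first.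
  by move=> A mA _; exact/esym/prodE.
rewrite -integral12_prod_meas1//.
rewrite (@eq_integral _ _ _ _ _ (fun x : R => (Ex P V * x)%:E)); last first.
  move=> x _; rewrite /fubini_F /f /=.
  rewrite (integral_distribution (X := Y) (f := fun y => (x * y)%:E))//=.
    by rewrite EFin_Ex ?ExZ 1?mulrC//; exact/intbleZ.
  by apply/measurable_EFinP; exact: measurable_funM.
  exact: (intbleZ x iV).
rewrite (integral_distribution (X := X) (f := fun y => (Ex P V * y)%:E))//=.
  by rewrite EFin_Ex ?ExZ 1?mulrC//; exact/intbleZ.
  by apply/measurable_EFinP; exact: measurable_funM.
exact: (intbleZ _ iU).
Qed.

End Independence.

(** * Finite independent families and leave-one-out sums *)

Section MutualIndependence.
Context (d : measure_display) (T : measurableType d) (R : realType).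
Variables (P : probability T R) (I : finType) (X : I -> T -> R).
Hypothesis mX : forall i, measurable_fun setT (X i).
Hypothesis indX : mutually_independent P X.

Lemma mutually_independent_comp (u : I -> R -> R) :
  (forall i, measurable_fun setT (u i)) ->
  mutually_independent P (fun i w => u i (X i w)).
Proof.
move=> mu B mB; apply: (indX (B := fun i => u i @^-1` B i)) => i.
exact: measurable_preimage.
Qed.

Lemma mutually_independent_pair i j : i != j -> independent P (X i) (X j).
Proof.
move=> ij A B mA mB.
pose C k : set R := if k == i then A else if k == j then B else setT.
have mC k : measurable (C k) by rewrite /C; case: ifP => // _; case: ifP.
have Ci : C i = A by rewrite /C eqxx.
have Cj : C j = B by rewrite /C eq_sym (negbTE ij) eqxx.
rewrite (_ : _ `&` _ = \bigcap_k (X k @^-1` C k)); last first.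
  apply/seteqP; split=> [w [wA wB] k _|w wC]; last first.
    by split; [move: (wC i Logic.I); rewrite /= Ci|move: (wC j Logic.I); rewrite /= Cj].
  by rewrite /= /C; case: eqP => [->//|_]; case: eqP => [->|].
rewrite indX// (bigD1 i)//= (bigD1 j) 1?eq_sym//= Ci Cj big1 ?mule1// => k.
move=> /andP[/negbTE ki /negbTE kj].
by rewrite /C ki kj preimage_setT probability_setT.
Qed.

(* For fixed A, the measures E |-> P (E `&` X i @^-1` A) and P (X i @^-1` A) * P
   agree on the pi-system of rectangles in the other coordinates. *)
Lemma mutually_independent_sum (i : I) :
  independent P (X i) (fun w => \sum_(j | j != i) X j w).
Proof.
move=> A B mA mB.
pose G := [set E | exists C : I -> set R, (forall j, measurable (C j)) /\
  E = \bigcap_(j in [set j | j != i]) (X j @^-1` C j)].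
have GT : G setT.
  by exists (fun=> setT); split=> //; apply/seteqP; split.
have GI : setI_closed G.
  move=> _ _ [C [mC ->]] [D [mD ->]]; exists (fun j => C j `&` D j); split.
    by move=> j; exact: measurableI.
  apply/seteqP; split=> [w [wC wD] j ji|w wCD]; first by split; [exact: wC|exact: wD].
  by split=> j ji; have [] := wCD j ji.
have Gm : G `<=` measurable.
  move=> _ [C [mC ->]]; apply: fin_bigcap_measurable => [|j _]; first exact: finite_finset.
  exact: measurable_preimage.
have mXA := measurable_preimage (mX i) mA.
have pA0 : 0 <= fine (P (X i @^-1` A)) by exact: fine_ge0.
pose m1 := mrestr P mXA; pose m2 := mscale (NngNum pA0) P.
have m12 E : G E -> m1 E = m2 E.
  move=> [C [mC ->]].
  (* The value of [C] at i is arbitrary, so it is overwritten: by the whole line to describe E, by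
     [A] to describe E intersected with the event on [X i]. *)
  pose D j := if j == i then A else C j.
  have mD j : measurable (D j) by rewrite /D; case: ifP.
  pose C' j := if j == i then setT else C j.
  have mC' j : measurable (C' j) by rewrite /C'; case: ifP.
  have -> : \bigcap_(j in [set j | j != i]) (X j @^-1` C j) =
            \bigcap_j (X j @^-1` C' j).
    apply/seteqP; split=> [w wC j _|w wC j /negbTE ji].
      by rewrite /= /C'; case: eqP => // /eqP ji; exact: wC.
    by move: (wC j Logic.I); rewrite /= /C' ji.
  have capE : (\bigcap_j (X j @^-1` C' j)) `&` (X i @^-1` A) =
              \bigcap_j (X j @^-1` D j).
    apply/seteqP; split=> [w [wC wA] j _|w wD].
      move: (wC j Logic.I); rewrite /= /D /C'.
      by case: eqP => // ->.
    split; last by move: (wD i Logic.I); rewrite /= /D eqxx.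
    by move=> j _; move: (wD j Logic.I); rewrite /= /D /C'; case: eqP.
  rewrite /m1 /mrestr capE /m2 /mscale /= fineK ?fin_num_measure//.
  rewrite !indX// (bigD1 i)//= [in RHS](bigD1 i)//=.
  rewrite /D /C' eqxx preimage_setT probability_setT mul1e; congr (_ * _)%E.
  by apply: eq_bigr => j /negbTE ->.
have key E : <<s G >> E -> m1 E = m2 E.
  apply: (g_sigma_algebra_measure_unique G Gm (fun=> setT)) => //.
    by apply/seteqP; split => // x _; exists 0%N.
  move=> k; rewrite /m1 /= /mrestr (le_lt_trans (probability_le1 _ _)) ?ltry//.
  by apply: measurableI => //; exact: measurableT.
(* The leave-one-out sum is measurable for the sigma-algebra generated by [G], so the equality of
   the two measures applies to its preimages. *)
have mW : measurable_fun (setT : set (g_sigma_algebraType G))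
    (fun w => \sum_(j | j != i) X j w).
  under [X in measurable_fun _ X]eq_fun do rewrite big_mkcond.
  apply: measurable_sum => j; case: (boolP (j != i)) => // ji.
  move=> _ C mC; rewrite setTI; apply: sub_sigma_algebra.
  exists (fun k => if k == j then C else setT); split.
    by move=> k; case: ifP.
  apply/seteqP; split=> [w wC k _|w /(_ j ji)]; last by rewrite /= eqxx.
  by rewrite /=; case: eqP => // ->.
have := key ((fun w => \sum_(j | j != i) X j w) @^-1` B).
rewrite /m1 /m2 /mrestr /mscale /= fineK ?fin_num_measure//.
rewrite setIC => -> //.
by rewrite -[X in <<s G>> X]setTI; exact: mW.
Qed.

End MutualIndependence.

(** * Stein's identity for independent sums *)

Section SteinIdentity.
Context (R : realType).

Definition outside (e x : R) : R := (e < `|x|)%R%:R.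

Lemma outside_ge0 (e x : R) : 0 <= outside e x.
Proof. by rewrite /outside ler0n. Qed.

Lemma outside_le1 (e x : R) : outside e x <= 1.
Proof. by rewrite /outside lern1 leq_b1. Qed.

Lemma measurable_outside (e : R) : measurable_fun setT (outside e).
Proof.
rewrite (_ : outside e = fun x => if e < `|x| then 1 else 0); last first.
  by apply/funext => x; rewrite /outside; case: ifP.
apply: measurable_fun_ifT => //.
by apply: measurable_fun_ltr => //; exact: measurableT_comp.
Qed.

(** The pointwise form of Chebyshev's inequality. *)
Lemma outside_le_sqr (e x : R) : 0 < e -> outside e x <= x ^+ 2 / e ^+ 2.
Proof.
move=> e0; rewrite /outside; case: (ltP e `|x|) => [ex|_].
  rewrite ler_pdivlMr ?exprn_gt0// mul1r -[leRHS]real_normK ?num_real//.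
  by rewrite lerXn2r ?nnegrE// ltW.
by rewrite divr_ge0// sqr_ge0.
Qed.

Variables (h dh : R -> R) (B w e : R).
Hypothesis hdh : forall x : R, is_derive x (1 : R) h (dh x).
Hypothesis e0 : 0 < e.
Hypothesis dhB : forall x, `|dh x| <= B.
Hypothesis dhw : forall x y, `|x - y| <= e -> `|dh x - dh y| <= w.

Let w0 : 0 <= w.
Proof.
by apply: le_trans (dhw (x := 0) (y := 0) _); rewrite subrr normr0 // ltW.
Qed.

Lemma is_derive_continuous : continuous h.
Proof.
move=> x; apply: differentiable_continuous; apply/derivable1_diffP.
by have [] := hdh x.
Qed.

(** Within distance [e] the modulus [w] applies; beyond it the crude bound 2 B is charged to the
    indicator, which later becomes Lindeberg's error term. *)
Lemma modulus_outside x y : `|dh x - dh y| <= w + 2 * B * outside e (x - y).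
Proof.
rewrite /outside; case: (ltP e `|x - y|) => [exy|/dhw xy]; last first.
  by rewrite mulr0 addr0.
rewrite (le_trans (ler_normB _ _))// mulr1 (le_trans (lerD (dhB x) (dhB y)))//.
by have := w0; lra.
Qed.

Lemma mean_value v x : exists2 c, `|c - v| <= `|x| & h (v + x) - h v = dh c * x.
Proof.
have wh a b : {within `[a, b], continuous h}.
  exact/continuous_subspaceT/is_derive_continuous.
have [x0|x0] := leP 0 x.
  have [|c] := @MVT_segment _ h dh v (v + x) _ (fun y _ => hdh y) (wh _ _).
    by rewrite lerDl.
  rewrite in_itv/= => /andP[vc cx] ->; exists c; last by congr (_ * _); ring.
  by rewrite !ger0_norm ?subr_ge0//; lra.
have [|c] := @MVT_segment _ h dh (v + x) v _ (fun y _ => hdh y) (wh _ _).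
  by rewrite gerDl ltW.
rewrite in_itv/= => /andP[vc cx] E; exists c.
  by rewrite ler0_norm ?ltr0_norm; lra.
by rewrite -[LHS]opprB E; ring.
Qed.

Lemma taylor1_outside v x :
  `|h (v + x) - h v - x * dh v| <= `|x| * (w + 2 * B * outside e x).
Proof.
have [c cx ->] := mean_value v x.
rewrite [dh c * x]mulrC -mulrBr normrM ler_wpM2l//.
apply: le_trans (modulus_outside c v) _.
rewrite lerD2l ler_wpM2l//; first by have := le_trans (normr_ge0 _) (dhB 0); lra.
rewrite /outside ler_nat; case: (ltP e `|c - v|) => // ec.
by rewrite (lt_le_trans ec cx).
Qed.

End SteinIdentity.

Lemma intble_sqr_outside (d : measure_display) (T : measurableType d)
    (R : realType) (P : probability T R) (U : T -> R) (e : R) : sqintble P U ->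
  intble P (fun w => U w ^+ 2 * outside e (U w)).
Proof.
move=> [mU iU2]; apply: intble_le iU2.
  apply: measurable_funM; first exact: measurable_funX.
  by apply: measurableT_comp => //; exact: measurable_outside.
move=> w; rewrite ger0_norm; last first.
  by apply: mulr_ge0; [exact: sqr_ge0|exact: outside_ge0].
by rewrite ler_piMr ?sqr_ge0 ?outside_le1.
Qed.

Section SteinSum.
Context (d : measure_display) (T : measurableType d) (R : realType).
Variables (P : probability T R) (I : finType) (X : I -> T -> R).
Hypothesis sX : forall i, sqintble P (X i).
Hypothesis indX : mutually_independent P X.
Hypothesis X0 : forall i, Ex P (X i) = 0.
Variables (h dh : R -> R) (A B m e : R).
Hypothesis hdh : forall x : R, is_derive x (1 : R) h (dh x).
Hypothesis cdh : continuous dh.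
Hypothesis e0 : 0 < e.
Hypothesis hA : forall x, `|h x| <= A.
Hypothesis dhB : forall x, `|dh x| <= B.
Hypothesis dhm : forall x y, `|x - y| <= e -> `|dh x - dh y| <= m.

Let mX i : measurable_fun setT (X i). Proof. by case: (sX i). Qed.
Let mh : measurable_fun setT h.
Proof.
exact: continuous_measurable_fun (@is_derive_continuous _ _ _ hdh).
Qed.
Let mdh : measurable_fun setT dh. Proof. exact: continuous_measurable_fun cdh. Qed.
Let m0 : 0 <= m.
Proof. by apply: le_trans (dhm (x := 0) (y := 0) _); rewrite subrr normr0// ltW. Qed.
Let B0 : 0 <= B. Proof. exact: le_trans (dhB 0). Qed.

Let V i w := \sum_(j | j != i) X j w.
Let W w := \sum_i X i w.

Let WE i w : W w = V i w + X i w.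
Proof. by rewrite /W (bigD1 i)//= addrC. Qed.

Let mV i : measurable_fun setT (V i).
Proof.
by have [] := sqintble_sum (P := P) (index_enum I) (A := fun j => j != i)
  (fun j _ => sX j).
Qed.

Let mW : measurable_fun setT W.
Proof. by have [] := sqintble_sum (P := P) (index_enum I) (A := xpredT) (fun j _ => sX j). Qed.

(* V i is independent of X i, so E[X i h(V i)] = 0 and
   E[X i ^+ 2 dh(V i)] = E[X i ^+ 2] E[dh(V i)]; expand h at V i to first order. *)
Lemma stein_term i :
  `|Ex P (fun w => X i w * h (W w)) -
    Ex P (fun w => X i w ^+ 2) * Ex P (fun w => dh (W w))| <=
  Ex P (fun w => X i w ^+ 2) *
    (2 * m + 2 * B * Ex P (fun w => X i w ^+ 2) / e ^+ 2) +
  2 * B * Ex P (fun w => X i w ^+ 2 * outside e (X i w)).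
Proof.
set s := Ex P (fun w => X i w ^+ 2).
have iX := sqintble_intble (sX i).
have iX2 : intble P (fun w => X i w ^+ 2) by case: (sX i).
have s0 : 0 <= s by apply: Ex_ge0 => w; exact: sqr_ge0.
have ihV : intble P (fun w => h (V i w)).
  by apply: (@intble_bounded _ _ _ _ _ A) => //; exact: measurableT_comp.
have idhV : intble P (fun w => dh (V i w)).
  by apply: (@intble_bounded _ _ _ _ _ B) => //; exact: measurableT_comp.
have idhW : intble P (fun w => dh (W w)).
  by apply: (@intble_bounded _ _ _ _ _ B) => //; exact: measurableT_comp.
have shW : sqintble P (fun w => h (W w)).
  by apply: (@sqintble_bounded _ _ _ _ _ A) => //; exact: measurableT_comp.
have iX2out := intble_sqr_outside e (sX i).
have ind := mutually_independent_sum mX indX i.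
have [iXhV EXhV] := independent_ExM iX ihV
  (independent_comp (u := id) (@measurable_id _ _ _) mh ind).
have [iX2dhV EX2dhV] := independent_ExM iX2 idhV
  (independent_comp (u := fun x => x ^+ 2) (@exprn_measurable _ _ 2) mdh ind).
rewrite X0 mul0r in EXhV.
have iXhW : intble P (fun w => X i w * h (W w)) by exact: sqintbleM.
have iXhD := intbleB iXhW iXhV.
have iD : intble P (fun w => X i w * h (W w) - X i w * h (V i w) -
    X i w ^+ 2 * dh (V i w)).
  exact: intbleB.
have -> : Ex P (fun w => X i w * h (W w)) - s * Ex P (fun w => dh (W w)) =
    Ex P (fun w => X i w * h (W w) - X i w * h (V i w) - X i w ^+ 2 * dh (V i w))
    + s * Ex P (fun w => dh (V i w) - dh (W w)).
  by rewrite !ExB// EXhV EX2dhV -/s; ring.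
(* The first bracket bounds the Taylor remainder. The second bounds the replacement of dh (V i) by
   dh (W), where Chebyshev's inequality estimates the probability of |X i| > e by s / e ^+ 2. *)
have -> : s * (2 * m + 2 * B * s / e ^+ 2) +
  2 * B * Ex P (fun w => X i w ^+ 2 * outside e (X i w)) =
  (m * s + 2 * B * Ex P (fun w => X i w ^+ 2 * outside e (X i w))) +
  s * (m + 2 * B * (s / e ^+ 2)) by ring.
apply: le_trans (ler_normD _ _) (lerD _ _).
  rewrite -ExZ// -ExZ// -ExD; [|exact: intbleZ..].
  apply: normr_Ex_le; first exact: intble_measurable iD.
    by apply: intbleD; exact: intbleZ.
  move=> w; rewrite (WE i).
  have -> : X i w * h (V i w + X i w) - X i w * h (V i w) - X i w ^+ 2 * dh (V i w)
     = X i w * (h (V i w + X i w) - h (V i w) - X i w * dh (V i w)) by ring.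
  rewrite normrM; have := taylor1_outside hdh e0 dhB dhm (V i w) (X i w).
  move=> /(ler_wpM2l (normr_ge0 (X i w))) /le_trans; apply.
  have -> : X i w ^+ 2 = `|X i w| * `|X i w|.
    by rewrite -expr2 real_normK ?num_real.
  by rewrite le_eqVlt; apply/orP; left; apply/eqP; ring.
rewrite normrM (ger0_norm s0) ler_wpM2l//.
have -> : m + 2 * B * (s / e ^+ 2) =
    Ex P (fun w => m + (2 * B / e ^+ 2) * X i w ^+ 2).
  rewrite ExD ?Ex_cst ?ExZ//; [by rewrite -/s; ring|exact: intble_cst|].
  exact: intbleZ.
apply: normr_Ex_le.
- exact: intble_measurable (intbleB idhV idhW).
- by apply: intbleD; [exact: intble_cst|exact: intbleZ].
move=> w; apply: le_trans (modulus_outside e0 dhB dhm _ _) _.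
rewrite lerD2l.
have -> : V i w - W w = - X i w by rewrite (WE i); ring.
have := outside_le_sqr (- X i w) e0; rewrite sqrrN.
move=> /(ler_wpM2l (mulr_ge0 (ler0n _ 2) B0)) /le_trans; apply.
by rewrite le_eqVlt; apply/orP; left; apply/eqP; ring.
Qed.

Lemma stein_sum :
  `|Ex P (fun w => W w * h (W w)) -
    (\sum_i Ex P (fun w => X i w ^+ 2)) * Ex P (fun w => dh (W w))| <=
  \sum_i (Ex P (fun w => X i w ^+ 2) *
      (2 * m + 2 * B * Ex P (fun w => X i w ^+ 2) / e ^+ 2) +
    2 * B * Ex P (fun w => X i w ^+ 2 * outside e (X i w))).
Proof.
have shW : sqintble P (fun w => h (W w)).
  by apply: (@sqintble_bounded _ _ _ _ _ A) => //; exact: measurableT_comp.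
rewrite (@eq_Ex _ _ _ P _ (fun w => \sum_i X i w * h (W w))); last first.
  by move=> w; rewrite mulr_suml.
rewrite Ex_sum; last by move=> i _; exact: sqintbleM.
rewrite mulr_suml -sumrB; apply: le_trans (ler_norm_sum _ _ _) _.
by apply: ler_sum => i _; exact: stein_term.
Qed.

End SteinSum.

(** * Second moments of independent sums, plain and truncated *)

Section IndependentSums.
Context (d : measure_display) (T : measurableType d) (R : realType).
Variables (P : probability T R) (I : finType).

(** Additivity of the variance. Nonzero means are allowed because truncating a centered variable
    destroys its centering. *)
Lemma Ex_sqr_sum (X : I -> T -> R) : (forall i, sqintble P (X i)) ->
  mutually_independent P X ->
  Ex P (fun w => (\sum_i X i w) ^+ 2) =
  \sum_i (Ex P (fun w => X i w ^+ 2) - Ex P (X i) ^+ 2) + (\sum_i Ex P (X i)) ^+ 2.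
Proof.
move=> sX indX.
have mX i : measurable_fun setT (X i) by case: (sX i).
have iXX i j : intble P (fun w => X i w * X j w) by exact: sqintbleM.
rewrite (@eq_Ex _ _ _ P _ (fun w => \sum_i \sum_j X i w * X j w)); last first.
  by move=> w; rewrite expr2 mulr_suml; apply: eq_bigr => i _; rewrite mulr_sumr.
rewrite Ex_sum; last by move=> i _; exact: intble_sum.
rewrite [in RHS]expr2 mulr_suml -big_split/=; apply: eq_bigr => i _.
rewrite Ex_sum// mulr_sumr (bigD1 i)//= [in RHS](bigD1 i)//=.
rewrite addrA -expr2 subrK; congr (_ + _).
apply: eq_bigr => j ji.
have [|_ ->//] := independent_ExM (sqintble_intble (sX i)) (sqintble_intble (sX j)).
by apply: mutually_independent_pair => //; rewrite eq_sym.
Qed.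

Variables (X : I -> T -> R) (K : R).
Hypothesis sX : forall i, sqintble P (X i).
Hypothesis indX : mutually_independent P X.
Hypothesis X0 : forall i, Ex P (X i) = 0.
Hypothesis X1 : \sum_i Ex P (fun w => X i w ^+ 2) <= 1.
Hypothesis K1 : 1 <= K.

Let mX i : measurable_fun setT (X i). Proof. by case: (sX i). Qed.

Let Y i w := X i w * outside K (X i w).
Let t i := Ex P (fun w => X i w ^+ 2 * outside K (X i w)).
Let S w := \sum_i X i w.

Let mo i : measurable_fun setT (fun w => outside K (X i w)).
Proof. by apply: measurableT_comp => //; exact: measurable_outside. Qed.

Let sY i : sqintble P (Y i).
Proof.
apply: sqintble_le (sX i); first exact: measurable_funM.
move=> w; rewrite normrM ler_piMr// ger0_norm ?outside_ge0//.
exact: outside_le1.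
Qed.

Let YX i w : Y i w * X i w = X i w ^+ 2 * outside K (X i w).
Proof. by rewrite /Y; ring. Qed.

Let Y2 i w : Y i w ^+ 2 = X i w ^+ 2 * outside K (X i w).
Proof.
rewrite /Y /outside; case: (_ < _)%R; rewrite /= ?mulr1 ?mulr0//.
by rewrite expr0n.
Qed.

Let it i : intble P (fun w => X i w ^+ 2 * outside K (X i w)).
Proof. exact: intble_sqr_outside. Qed.

Let normY i w : `|Y i w| <= K^-1 * (X i w ^+ 2 * outside K (X i w)).
Proof.
have K0 : 0 < K by exact: lt_le_trans ltr01 K1.
rewrite /Y /outside; case: ltP => [KX|_]; rewrite /= ?mulr1 ?mulr0 ?normr0//.
rewrite -real_normK ?num_real// expr2 mulrA ler_peMl//.
by rewrite mulrC ler_pdivlMr// mul1r ltW.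
Qed.

Let EY i : Ex P (fun w => `|Y i w|) <= K^-1 * t i.
Proof.
rewrite -ExZ//; apply: Ex_le => //; last exact: intbleZ.
exact/intble_norm/sqintble_intble.
Qed.

(* With v the left-hand side and Y i the part of X i outside [-K, K], independence
   gives E[(\sum_i Y i) S] = v and E[(\sum_i Y i) ^+ 2] <= v + v ^+ 2. Splitting according to
   whether |S| <= K / 4 and using Young's inequality yields
   v <= v / 4 + v / 2 + E[S ^+ 2; |S| > K / 4]. *)
Lemma truncated_second_moments_le : \sum_i t i <=
  4 * Ex P (fun w => S w ^+ 2 * outside (K / 4) (S w)).
Proof.
have K0 : 0 < K by exact: lt_le_trans ltr01 K1.
have t0 i : 0 <= t i.
  by apply: Ex_ge0 => w; apply: mulr_ge0; [exact: sqr_ge0|exact: outside_ge0].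
set v := \sum_i t i; set q := Ex P _.
have v0 : 0 <= v by apply: sumr_ge0.
have v1 : v <= 1.
  apply: le_trans X1; apply: ler_sum => i _; apply: Ex_le => //.
    by case: (sX i).
  by move=> w; rewrite ler_piMr ?sqr_ge0 ?outside_le1.
have iX i := sqintble_intble (sX i); have iY i := sqintble_intble (sY i).
have sS : sqintble P S by apply: sqintble_sum.
have sT : sqintble P (fun w => \sum_i Y i w) by apply: sqintble_sum.
have iSo := intble_sqr_outside (K / 4) sS.
have indY : mutually_independent P Y.
  apply: (mutually_independent_comp indX (u := fun _ x => x * outside K x)) => // _.
  by apply: measurable_funM => //; exact: measurable_outside.
(* Only the diagonal survives: for j != i, [Y i] is a function of [X i], hence independent of the
   centered [X j]. *)
have ETS : Ex P (fun w => (\sum_i Y i w) * S w) = v.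
  rewrite (@eq_Ex _ _ _ P _ (fun w => \sum_i \sum_j Y i w * X j w)); last first.
    by move=> w; rewrite mulr_suml; apply: eq_bigr => i _; rewrite mulr_sumr.
  have iYX i j : intble P (fun w => Y i w * X j w) by exact: sqintbleM.
  rewrite Ex_sum; last by move=> i _; exact: intble_sum.
  apply: eq_bigr => i _; rewrite Ex_sum// (bigD1 i)//= big1 ?addr0.
    by apply: eq_Ex => w; exact: YX.
  move=> j ji.
  have [|_ ->//] := independent_ExM (iY i) (iX j); last by rewrite X0 mulr0.
  apply: (independent_comp (u := fun x => x * outside K x) (v := id)) => //.
    by apply: measurable_funM => //; exact: measurable_outside.
  by apply: mutually_independent_pair => //; rewrite eq_sym.
have EYv : `|\sum_i Ex P (Y i)| <= v.
  apply: le_trans (ler_norm_sum _ _ _) _; apply: ler_sum => i _.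
  apply: le_trans (normr_Ex (iY i)) (le_trans (EY i) _).
  by rewrite ler_piMl// invf_le1.
have ET2 : Ex P (fun w => (\sum_i Y i w) ^+ 2) <= 2 * v.
  rewrite Ex_sqr_sum//.
  have : \sum_i (Ex P (fun w => Y i w ^+ 2) - Ex P (Y i) ^+ 2) <= v.
    apply: ler_sum => i _; rewrite lerBlDr (@eq_Ex _ _ _ P _ _ (Y2 i)).
    by rewrite lerDl sqr_ge0.
  (* This uses v <= 1, to pass from v ^+ 2 to v. *)
  have : (\sum_i Ex P (Y i)) ^+ 2 <= v.
    rewrite -real_normK ?num_real// expr2.
    by apply: le_trans (ler_pM _ _ EYv EYv) _ => //; rewrite ler_piMr.
  lra.
have : v <= K / 4 * \sum_i Ex P (fun w => `|Y i w|) +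
    4^-1 * Ex P (fun w => (\sum_i Y i w) ^+ 2) + q.
  rewrite -ETS -Ex_sum; last by move=> i _; exact: intble_norm.
  have iYn : intble P (fun w => \sum_i `|Y i w|).
    by apply: intble_sum => i _; exact: intble_norm.
  have iT2 : intble P (fun w => (\sum_i Y i w) ^+ 2) by case: sT.
  rewrite -ExZ// -ExZ// -ExD; [|exact: intbleZ..].
  rewrite -ExD//; last by apply: intbleD; exact: intbleZ.
  apply: Ex_le; first by apply: sqintbleM.
    by apply: intbleD => //; apply: intbleD; exact: intbleZ.
  move=> w; apply: le_trans (ler_norm _) _; rewrite normrM.
  have Ty : `|\sum_i Y i w| <= \sum_i `|Y i w| by exact: ler_norm_sum.
  rewrite -[(\sum_i Y i w) ^+ 2]real_normK ?num_real//.
  rewrite -[S w ^+ 2]real_normK ?num_real// /outside.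
  set a := `|\sum_i Y i w| in Ty *; set b := `|S w|.
  have a0 : 0 <= a by exact: normr_ge0.
  have b0 : 0 <= b by exact: normr_ge0.
  (* Where |S| > K / 4, Young's inequality a b <= a ^+ 2 / 4 + b ^+ 2 is used; elsewhere b <= K / 4
     is enough. *)
  case: ltP => [Kb|bK]; rewrite /= ?mulr1 ?mulr0.
    have : 0 <= (a / 2 - b) ^+ 2 by exact: sqr_ge0.
    have : 0 <= K / 4 * \sum_i `|Y i w|.
      by apply: mulr_ge0; [rewrite divr_ge0// ltW|exact: le_trans a0 Ty].
    by nra.
  have : a * b <= K / 4 * \sum_i `|Y i w| by rewrite mulrC ler_pM.
  have : 0 <= a ^+ 2 by exact: sqr_ge0.
  lra.
(* Since |Y i| >= K wherever [Y i] is nonzero, E|Y i| costs a factor 1 / K, which cancels the K of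
   the threshold. *)
have : K / 4 * \sum_i Ex P (fun w => `|Y i w|) <= v / 4.
  rewrite [v / 4]mulrC.
  have -> : 4^-1 * v = K / 4 * (K^-1 * v) by field; rewrite gt_eqF.
  rewrite ler_wpM2l ?divr_ge0 ?(ltW K0)// mulr_sumr.
  by apply: ler_sum => i _; exact: EY.
lra.
Qed.

End IndependentSums.

(** * Increments of the process *)

Lemma identically_distributed_Ex (d : measure_display) (T : measurableType d)
    (R : realType) (P : probability T R) (U V : T -> R) (u : R -> R) :
  measurable_fun setT U -> measurable_fun setT V -> measurable_fun setT u ->
  (forall x, 0 <= u x) -> identically_distributed P U V ->
  Ex P (fun w => u (U w)) = Ex P (fun w => u (V w)).
Proof.
move=> mU mV mu u0 UV; rewrite /Ex /Rintegral; congr fine.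
pose X : {RV P >-> R} := HB.pack U (isMeasurableFun.Build _ _ _ _ U mU).
pose Y : {RV P >-> R} := HB.pack V (isMeasurableFun.Build _ _ _ _ V mV).
have muE : measurable_fun setT (EFin \o u) by exact/measurable_EFinP.
have u0E x : (0 <= (EFin \o u) x)%E by rewrite lee_fin.
rewrite -(ge0_integral_distribution X muE u0E).
rewrite -(ge0_integral_distribution Y muE u0E).
by apply: eq_measure_integral => A mA _; exact: UV.
Qed.

Section LevyMoments.
Context (R : realType) (d : measure_display) (T : measurableType d).
Variables (P : probability T R) (L : R -> {RV P >-> R}).
Hypothesis hL : levy_process L.
Hypothesis hL2 : forall s : R, (L s : T -> R) \in Lfun P 2%:E.
Hypothesis hL_mean : forall s : R, ('E_P[L s] = 0)%E.
Hypothesis hL_var : ('V_P[L 1%R] = 1)%E.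

Definition increment (s t : R) (w : T) : R := L t w - L s w.

Lemma increment_sqintble s t : sqintble P (increment s t).
Proof.
have sL r : sqintble P (L r) by split=> //; exact: Lfun2_integrable_sqr.
exact: sqintbleB.
Qed.

Lemma measurable_increment s t : measurable_fun setT (increment s t).
Proof. by case: (increment_sqintble s t). Qed.

Lemma increment_mean0 s t : Ex P (increment s t) = 0.
Proof.
have L0 r : Ex P (L r) = 0.
  by have := hL_mean r; rewrite unlock /Ex /Rintegral => ->.
have iL r : intble P (L r).
  by apply: sqintble_intble; split=> //; exact: Lfun2_integrable_sqr.
by rewrite ExB// !L0 subrr.
Qed.

Lemma increment_stationary (u : R -> R) s t : measurable_fun setT u ->
  (forall x, 0 <= u x) -> s <= t ->
  Ex P (fun w => u (increment s t w)) = Ex P (fun w => u (increment 0 (t - s) w)).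
Proof.
move=> mu u0 st; apply: identically_distributed_Ex => //.
- exact: measurable_increment.
- exact: measurable_increment.
have := levy_stationary hL s (s := 0) (t := t - s).
by rewrite subrK add0r subr_ge0; exact.
Qed.

Lemma increments_independent (n : nat) (t : nat -> R) : nondecreasing_seq t ->
  mutually_independent P (fun i : 'I_n => increment (t i) (t i.+1)).
Proof. exact: (levy_independent hL). Qed.

Let v (x : R) := Ex P (fun w => increment 0 x w ^+ 2).

Let v_ge0 x : 0 <= v x. Proof. by apply: Ex_ge0 => w; exact: sqr_ge0. Qed.

Let v0 : v 0 = 0.
Proof.
rewrite /v -[RHS](Ex_cst P 0); apply: eq_Ex => w.
by rewrite /increment subrr expr0n.
Qed.

Let increment_v s t : s <= t ->
  Ex P (fun w => increment s t w ^+ 2) = v (t - s).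
Proof.
move=> st; apply: (increment_stationary (u := fun x => x ^+ 2)) => //.
by move=> x; exact: sqr_ge0.
Qed.

Let vD x y : 0 <= x -> 0 <= y -> v (x + y) = v x + v y.
Proof.
move=> x0 y0.
(* The partition 0, x, x + y, continued by a constant so as to be nondecreasing on all of [nat]. *)
pose t (n : nat) : R := if n is n'.+1 then (if n' is 0%N then x else x + y) else 0.
have ndt : nondecreasing_seq t.
  apply/nondecreasing_seqP => -[|[|n]] //=; by rewrite lerDl.
have ind := increments_independent (n := 2) ndt.
have := Ex_sqr_sum (fun i : 'I_2 => increment_sqintble (t i) (t i.+1)) ind.
rewrite [in X in _ = _ + X ^+ 2]big1 => [|i _]; last exact: increment_mean0.
rewrite expr0n/= addr0 !big_ord_recl big_ord0/= addr0 !increment_mean0 expr0n/= !subr0.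
rewrite (@increment_v x (x + y)) ?lerDl// [x + y - x]addrAC subrr add0r -/(v x) => <-.
apply: eq_Ex => w; rewrite !big_ord_recl big_ord0/= addr0; congr (_ ^+ 2).
by rewrite /increment; ring.
Qed.

Let vMn x n : 0 <= x -> v (x *+ n) = v x *+ n.
Proof.
move=> x0; elim: n => [|n IH]; first by rewrite !mulr0n v0.
by rewrite !mulrS vD ?mulrn_wge0// IH.
Qed.

(** The variance hypothesis concerns [L 1], while the increment subtracts [L 0], which vanishes only
    almost surely; the two second moments are therefore compared up to a null set. *)
Let v1 : v 1 = 1.
Proof.
apply: EFin_inj.
have [_ i2] := increment_sqintble 0 1; rewrite -(EFin_Ex i2).
have := hL_var; rewrite varianceE ?hL2// hL_mean expe2 mule0 sube0 unlock => <-.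
apply: ae_eq_integral => //.
- exact: measurable_int i2.
- exact: measurable_int (Lfun2_integrable_sqr (hL2 1)).
apply: filterS (levy_at0 hL) => w L0 _.
by rewrite /increment L0 subr0.
Qed.

Let v_mono x y : 0 <= x <= y -> v x <= v y.
Proof.
move=> /andP[x0 xy]; rewrite -(subrK x y) addrC vD ?subr_ge0//.
by rewrite lerDl.
Qed.

(* v is additive and monotone with v 1 = 1, so v (x *+ n) and x *+ n lie between the
   same two consecutive integers for every n. *)
Let vE x : 0 <= x -> v x = x.
Proof.
move=> x0; apply/eqP; rewrite -subr_eq0 -normr_eq0; apply/negPn/negP => nz.
have p0 : 0 < `|v x - x| by rewrite lt_neqAle eq_sym nz normr_ge0.
have [n] : exists n : nat, 1 < `|v x - x| *+ n.
  exists (Num.bound `|v x - x|^-1); rewrite -mulr_natr.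
  rewrite mulrC -ltr_pdivrMr// div1r.
  by apply: archi_boundP; rewrite invr_ge0.
apply/negP; rewrite -leNgt.
pose k := Num.truncn (x *+ n).
have xn0 : 0 <= x *+ n by rewrite mulrn_wge0.
have /andP[k1 k2] : k%:R <= x *+ n < k.+1%:R by apply: truncn_itv.
have vk m : v m%:R = m%:R by rewrite vMn// v1.
have : v k%:R <= v (x *+ n) by rewrite v_mono// ler0n.
have : v (x *+ n) <= v k.+1%:R by rewrite v_mono// xn0 ltW.
rewrite !vk vMn// -normrMn mulrnBl ler_norml -natr1 => a b.
by apply/andP; split; move: k2; rewrite -natr1; lra.
Qed.

Lemma increment_sqr s t : s <= t -> Ex P (fun w => increment s t w ^+ 2) = t - s.
Proof. by move=> st; rewrite increment_v// vE// subr_ge0. Qed.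

End LevyMoments.

(** Dominated convergence: the truncated squares are dominated by U ^+ 2 and vanish at each point
    once the integer level exceeds |U w|. *)
Lemma sqintble_tail (d : measure_display) (T : measurableType d) (R : realType)
    (P : probability T R) (U : T -> R) (e : R) : sqintble P U -> 0 < e ->
  exists2 M, 1 <= M & Ex P (fun w => U w ^+ 2 * outside M (U w)) <= e.
Proof.
move=> [mU iU2] e0.
pose F (n : nat) w := U w ^+ 2 * outside n%:R (U w).
have mF n : measurable_fun setT (F n).
  apply: measurable_funM; first exact: intble_measurable iU2.
  by apply: measurableT_comp => //; exact: measurable_outside.
have FU n w : `|F n w| <= U w ^+ 2.
  rewrite ger0_norm ?ler_piMr ?sqr_ge0 ?outside_le1//.
  by apply: mulr_ge0; [exact: sqr_ge0|exact: outside_ge0].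
have [_ _] : [/\ P.-integrable setT (cst 0%E),
   [sequence (\int[P]_x `|(F n x)%:E - 0|)%E]_n @ \oo --> 0%E &
   [sequence (\int[P]_x (F n x)%:E)%E]_n @ \oo --> (\int[P]_x 0)%E].
  apply: (dominated_convergence _ _ _ _ iU2) => //.
  - by move=> n; exact/measurable_EFinP.
  - apply: aeW => w _; apply/fine_cvgP; split; first exact: nearW.
    apply/cvgrPdist_le => /= r r0.
    exists (Num.bound `|U w|) => // n /= Un.
    have Uwn : `|U w| <= n%:R.
      apply: le_trans (ltW (archi_boundP (normr_ge0 (U w)))) _.
      by rewrite ler_nat.
    by rewrite /F /outside ltNge Uwn mulr0 subrr normr0 ltW.
  - by apply: aeW => w n _ /=; rewrite lee_fin.
rewrite integral0 => /fine_cvgP[_ /cvgrPdist_le/(_ e e0)[N _ HN]].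
exists (N.+1%:R); first by rewrite ler1n.
have := HN N.+1 (leqnSn N); rewrite /= sub0r normrN; apply: le_trans.
exact: ler_norm.
Qed.

(** * Uniform tail bound for short increments *)

Section LevyTail.
Context (R : realType) (d : measure_display) (T : measurableType d).
Variables (P : probability T R) (L : R -> {RV P >-> R}).
Hypothesis hL : levy_process L.
Hypothesis hL2 : forall s : R, (L s : T -> R) \in Lfun P 2%:E.
Hypothesis hL_mean : forall s : R, ('E_P[L s] = 0)%E.
Hypothesis hL_var : ('V_P[L 1%R] = 1)%E.

Let sq_outside (K x : R) := x ^+ 2 * outside K x.

Let sq_outside_ge0 (K x : R) : 0 <= sq_outside K x.
Proof. by apply: mulr_ge0; [exact: sqr_ge0|exact: outside_ge0]. Qed.

Let measurable_sq_outside (K : R) : measurable_fun setT (sq_outside K).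
Proof.
apply: measurable_funM; last exact: measurable_outside.
exact: exprn_measurable.
Qed.

(* L 1 - L 0 is split into N = trunc (t - s)^-1 increments distributed as L t - L s
   and a remainder. *)
Lemma increment_tail_le (K s t : R) : 1 <= K -> s <= t <= s + 1 ->
  Ex P (fun w => increment L s t w ^+ 2 * outside K (increment L s t w)) <=
  8 * (t - s) *
  Ex P (fun w => increment L 0 1 w ^+ 2 * outside (K / 4) (increment L 0 1 w)).
Proof.
move=> K1 /andP[]; rewrite le_eqVlt => /predU1P[<- _|st ts].
  rewrite subrr mulr0 mul0r (@eq_Ex _ _ _ _ _ (fun=> 0)) ?Ex_cst// => w.
  by rewrite /increment subrr expr0n mul0r.
pose x := t - s.
have x0 : 0 < x by rewrite subr_gt0.
have x1 : x <= 1 by rewrite lerBlDl.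
pose N := Num.truncn x^-1.
have /andP[N1 N2] : N%:R <= x^-1 < N.+1%:R by apply: truncn_itv; rewrite invr_ge0 ltW.
have Nx : N%:R * x <= 1 by rewrite -ler_pdivlMr// div1r.
have N0 : (1 : R) <= N%:R.
  have : 1 < N.+1%:R :> R by apply: le_lt_trans N2; rewrite invf_ge1.
  by rewrite ltr1n ler1n ltnS.
(* The first N intervals have length x; the last one, from N x to 1, is the remainder, and its
   nonnegative contribution is dropped below. *)
pose u (n : nat) : R := if (n <= N)%N then n%:R * x else 1.
have ndu : nondecreasing_seq u.
  apply/nondecreasing_seqP => n; rewrite /u; case: (leqP n.+1 N) => nN.
    by rewrite (ltnW nN) ler_wpM2r ?ler_nat// ltW.
  case: (leqP n N) => // nN'.
  by apply: le_trans Nx; rewrite ler_wpM2r ?ler_nat// ltW.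
have su i j : sqintble P (increment L i j) by exact: increment_sqintble.
have ind := increments_independent hL (n := N.+1) ndu.
have sumD w : \sum_(i < N.+1) increment L (u i) (u i.+1) w = increment L 0 1 w.
  rewrite -(big_mkord xpredT (fun i => increment L (u i) (u i.+1) w)).
  by rewrite /increment telescope_sumr// /u leq0n ltnn mul0r.
have X1 : \sum_(i < N.+1) Ex P (fun w => increment L (u i) (u i.+1) w ^+ 2) <= 1.
  rewrite (eq_bigr (fun i : 'I__ => u i.+1 - u i)); last first.
    by move=> i _; rewrite (increment_sqr hL hL2 hL_mean hL_var)//; exact: ndu.
  rewrite -(big_mkord xpredT (fun i => u i.+1 - u i)) telescope_sumr//.
  by rewrite /u leq0n ltnn mul0r subr0.
have := truncated_second_moments_le (fun i : 'I_N.+1 => su (u i) (u i.+1)) ind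
  (fun i => increment_mean0 hL2 hL_mean _ _) X1 K1.
rewrite (@eq_Ex _ _ _ _ _ (fun w => sq_outside (K / 4) (increment L 0 1 w))); last first.
  by move=> w; rewrite sumD.
set q := Ex P _ => key.
have -> : Ex P (fun w => increment L s t w ^+ 2 * outside K (increment L s t w)) =
    Ex P (fun w => sq_outside K (increment L 0 x w)).
  exact: (increment_stationary hL hL2 (measurable_sq_outside K)
    (sq_outside_ge0 K) (ltW st)).
set r := Ex P _.
have r0 : 0 <= r by apply: Ex_ge0.
have : N%:R * r <= 4 * q.
  apply: le_trans key; rewrite big_ord_recr/= -[leLHS]addr0 lerD//; last first.
    by apply: Ex_ge0 => w; exact: sq_outside_ge0.
  rewrite (eq_bigr (fun=> r)) ?sumr_const ?card_ord ?mulr_natl// => i _.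
  rewrite (increment_stationary hL hL2 (measurable_sq_outside K)
    (sq_outside_ge0 K)); last exact: ndu.
  by rewrite /u (ltn_ord i) (ltnW (ltn_ord i)) -mulrBl -natrB ?leqnSn// subSnn mul1r.
(* Truncation gives N x > 1 - x, and N >= 1 gives N x >= x, so N x >= 1 / 2. This factor 2 turns the
   constant 4 into 8. *)
have : 1 <= 2 * (N%:R * x).
  have : 1 < N.+1%:R * x by rewrite -ltr_pdivrMr// div1r.
  rewrite -natr1 mulrDl mul1r => h.
  have : x <= N%:R * x by rewrite ler_peMl// ltW.
  lra.
rewrite -/x => h1 h2.
have h3 : r <= 2 * (N%:R * x) * r by rewrite ler_peMl.
apply: le_trans h3 _.
have -> : 2 * (N%:R * x) * r = 2 * x * (N%:R * r) by ring.
have -> : 8 * x * q = 2 * x * (4 * q) by ring.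
by rewrite ler_wpM2l// mulr_ge0// ltW.
Qed.

End LevyTail.

(** * Integrals of step functions: refinement, isometry, Stein's identity *)

Section StepIntegral.
Context (R : realType) (d : measure_display) (T : measurableType d).
Variables (P : probability T R) (L : R -> {RV P >-> R}).

Lemma big_ord_mul (n r : nat) (F : nat -> R) :
  \sum_(i < n * r) F i = \sum_(q < n) \sum_(q * r <= k < q.+1 * r) F k.
Proof.
rewrite -(big_mkord xpredT F) -(big_mkord xpredT (fun q => \sum_(q * r <= k < q.+1 * r) F k)).
elim: n => [|n IH]; first by rewrite mul0n !big_nil.
rewrite big_nat_recr//= -IH -big_cat_nat//; first by rewrite leq_mul2r leqnSn orbT.
Qed.

(* Cuts each [t q, t q.+1] into r pieces of equal length. *)
Definition refined (r : nat) (t : nat -> R) (k : nat) : R :=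
  t (k %/ r)%N + (k %% r)%:R / r%:R * (t (k %/ r).+1 - t (k %/ r)%N).

(** The case l = r is included, so that the right end of a block can be computed from the block
    itself; there the division already moves on to q.+1, with the same value. *)
Lemma refinedS (r q l : nat) (t : nat -> R) : (l <= r)%N -> (0 < r)%N ->
  refined r t (q * r + l) = t q + l%:R / r%:R * (t q.+1 - t q).
Proof.
move=> lr r0; rewrite /refined; have := lr; rewrite leq_eqVlt => /predU1P[->|lt_lr].
  have rR : r%:R != 0 :> R by rewrite pnatr_eq0 -lt0n.
  by rewrite -mulSnr mulnK// modnMl mul0r mul0r addr0 (divff rR) mul1r addrC subrK.
by rewrite divnMDl// divn_small// addn0 modnMDl modn_small.
Qed.

Lemma refinedB (r k : nat) (t : nat -> R) : (0 < r)%N ->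
  refined r t k.+1 - refined r t k = (t (k %/ r).+1 - t (k %/ r)%N) / r%:R.
Proof.
move=> r0; have kr : (k %% r < r)%N by rewrite ltn_mod.
rewrite {1 2}(divn_eq k r) -addnS !refinedS//; last exact: ltnW.
by rewrite -natr1; field; rewrite pnatr_eq0 -lt0n.
Qed.

Lemma refined_nondecreasing (r : nat) (t : nat -> R) : (0 < r)%N ->
  nondecreasing_seq t -> nondecreasing_seq (refined r t).
Proof.
move=> r0 ndt; apply/nondecreasing_seqP => k.
by rewrite -subr_ge0 refinedB// divr_ge0// subr_ge0 ndt.
Qed.

(** The coefficient is constant on each block of [r] pieces, on which the increments telescope. *)
Lemma refined_step_integral (n r : nat) (t c : nat -> R) w : (0 < r)%N ->
  step_integral L (n * r) (refined r t) (fun k => c (k %/ r)%N) w =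
  step_integral L n t c w.
Proof.
move=> r0; rewrite /step_integral.
rewrite (big_ord_mul n r (fun k => c (k %/ r)%N *
  (L (refined r t k.+1) w - L (refined r t k) w))).
apply: eq_bigr => q _.
rewrite (eq_big_nat _ _ (F2 := fun k => c q *
  (L (refined r t k.+1) w - L (refined r t k) w))); last first.
  move=> k /andP[qk kq]; suff -> : (k %/ r)%N = q by [].
  by apply/eqP; rewrite eqn_leq leq_divRL// qk andbT -ltnS ltn_divLR.
rewrite -mulr_sumr telescope_sumr; last by rewrite leq_mul2r leqnSn orbT.
congr (c q * (L _ w - L _ w)).
  by rewrite mulSnr refinedS// divff ?mul1r ?[RHS]addrC ?subrKC// pnatr_eq0 -lt0n.
by rewrite -[(q * r)%N]addn0 refinedS// mul0r mul0r addr0.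
Qed.

Hypothesis hL : levy_process L.
Hypothesis hL2 : forall s : R, (L s : T -> R) \in Lfun P 2%:E.
Hypothesis hL_mean : forall s : R, ('E_P[L s] = 0)%E.
Hypothesis hL_var : ('V_P[L 1%R] = 1)%E.

Lemma scaled_increments_independent n (t c : nat -> R) : nondecreasing_seq t ->
  mutually_independent P (fun (i : 'I_n) w => c i * increment L (t i) (t i.+1) w).
Proof.
move=> ndt.
apply: (mutually_independent_comp (increments_independent hL (n := n) ndt)
  (u := fun (i : 'I_n) x => c i * x)).
by move=> i; exact: mulrl_measurable.
Qed.

Lemma scaled_increment_sqintble (c s t : R) :
  sqintble P (fun w => c * increment L s t w).
Proof. by apply: sqintbleZ; exact: increment_sqintble. Qed.

Lemma scaled_increment_mean0 (c s t : R) :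
  Ex P (fun w => c * increment L s t w) = 0.
Proof.
rewrite ExZ ?(increment_mean0 hL2) ?mulr0//.
by apply: sqintble_intble; exact: increment_sqintble.
Qed.

Lemma scaled_increment_sqr (c s t : R) : s <= t ->
  Ex P (fun w => (c * increment L s t w) ^+ 2) = c ^+ 2 * (t - s).
Proof.
move=> st; rewrite -(increment_sqr hL hL2 hL_mean hL_var st) -ExZ.
  by apply: eq_Ex => w; rewrite exprMn.
by case: (increment_sqintble hL2 s t).
Qed.

Lemma step_integral_sqintble n t c : sqintble P (step_integral L n t c).
Proof. by apply: sqintble_sum => i _; exact: scaled_increment_sqintble. Qed.

(** The cross terms vanish because the increments are centered and independent. By
    [integral_step_fun] and [step_fun_comp], the right-hand side is the squared L^2 norm of the step
    function. *)
Lemma step_integral_isometry n (t c : nat -> R) : nondecreasing_seq t ->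
  Ex P (fun w => step_integral L n t c w ^+ 2) =
  \sum_(i < n) c i ^+ 2 * (t i.+1 - t i).
Proof.
move=> ndt; rewrite [LHS]Ex_sqr_sum; last 2 first.
- by move=> i; exact: scaled_increment_sqintble.
- exact: scaled_increments_independent.
rewrite [X in _ + X ^+ 2]big1 => [|i _]; last exact: scaled_increment_mean0.
rewrite expr0n/= addr0; apply: eq_bigr => i _.
by rewrite scaled_increment_mean0 expr0n/= subr0 scaled_increment_sqr// ndt.
Qed.

Variables (h dh : R -> R) (A B m e K eta : R).
Hypothesis hdh : forall x : R, is_derive x (1 : R) h (dh x).
Hypothesis cdh : continuous dh.
Hypothesis e0 : 0 < e.
Hypothesis hA : forall x, `|h x| <= A.
Hypothesis dhB : forall x, `|dh x| <= B.
Hypothesis dhm : forall x y, `|x - y| <= e -> `|dh x - dh y| <= m.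
Hypothesis K1 : 1 <= K.
Hypothesis eta0 : 0 <= eta.
Hypothesis Keta : K * eta <= e.

Let q := Ex P (fun w => increment L 0 1 w ^+ 2 * outside (K / 4) (increment L 0 1 w)).

(** With mesh at most 1 each summand has variance s <= eta ^+ 2, and by [increment_tail_le] its tail
    beyond [e] is at most 8 s q, whence 16 B q. All errors are thus proportional to s, and summing
    the s restores E[W ^+ 2]. *)
Let stein_step_integral_mesh1 n (t c : nat -> R) : nondecreasing_seq t ->
  (forall i, (i < n)%N -> t i.+1 <= t i + 1) ->
  (forall i, `|c i| <= eta) ->
  let W := step_integral L n t c in
  (`|Ex P (fun w => W w * h (W w)) -
    Ex P (fun w => W w ^+ 2) * Ex P (fun w => dh (W w))| <=
  Ex P (fun w => W w ^+ 2) * (2 * m + 2 * B * (eta ^+ 2 / e ^+ 2) + 16 * B * q) : Prop).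
Proof.
move=> ndt mesh ceta W.
have B0 : 0 <= B by exact: le_trans (dhB 0).
have tt i : t i <= t i.+1 by exact: ndt.
pose X (i : 'I_n) w := c i * increment L (t i) (t i.+1) w.
have EW2 : Ex P (fun w => W w ^+ 2) = \sum_(i < n) Ex P (fun w => X i w ^+ 2).
  rewrite step_integral_isometry//; apply: eq_bigr => i _.
  by rewrite scaled_increment_sqr.
rewrite EW2.
apply: le_trans (stein_sum (X := X) _ _ _ hdh cdh e0 hA dhB dhm) _.
- by move=> i; exact: scaled_increment_sqintble.
- exact: scaled_increments_independent.
- by move=> i; exact: scaled_increment_mean0.
rewrite mulr_suml; apply: ler_sum => i _.
set s := Ex P (fun w => X i w ^+ 2).
have sE : s = c i ^+ 2 * (t i.+1 - t i) by rewrite /s scaled_increment_sqr.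
have s0 : 0 <= s by apply: Ex_ge0 => w; exact: sqr_ge0.
have ci2 : c i ^+ 2 <= eta ^+ 2.
  by rewrite -real_normK ?num_real// lerXn2r ?nnegrE.
have seta : s <= eta ^+ 2.
  rewrite sE -[leRHS]mulr1 ler_pM ?sqr_ge0 ?subr_ge0//.
  by rewrite lerBlDl mesh.
have tail : Ex P (fun w => X i w ^+ 2 * outside e (X i w)) <= 8 * s * q.
  have -> : 8 * s * q = c i ^+ 2 * (8 * (t i.+1 - t i) * q) by rewrite sE; ring.
  have := increment_tail_le hL hL2 hL_mean hL_var (s := t i) (t := t i.+1) K1.
  rewrite tt mesh// => /(_ isT) /(ler_wpM2l (sqr_ge0 (c i))).
  apply: le_trans.
  have iDK := intble_sqr_outside K (increment_sqintble hL2 (t i) (t i.+1)).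
  rewrite -ExZ//; apply: Ex_le => //.
  - exact: (intble_sqr_outside e (scaled_increment_sqintble (c i) (t i) (t i.+1))).
  - exact: intbleZ.
  move=> w; rewrite exprMn -mulrA ler_wpM2l ?sqr_ge0// ler_wpM2l ?sqr_ge0//.
  (* As |c i| <= eta and K eta <= e, |c i D| > e is impossible when |D| <= K. *)
  rewrite /outside /X normrM ler_nat; case: (ltP e) => // ec.
  case: ltP => // DK; move: ec; rewrite ltNge => /negP[]; apply: le_trans Keta.
  by rewrite mulrC ler_pM.
rewrite -/s.
have -> : s * (2 * m + 2 * B * (eta ^+ 2 / e ^+ 2) + 16 * B * q) =
  s * (2 * m + 2 * B * (eta ^+ 2 / e ^+ 2)) + 2 * B * (8 * s * q) by ring.
apply: lerD; last by rewrite ler_wpM2l// mulr_ge0.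
rewrite ler_wpM2l// lerD2l -mulrA ler_wpM2l ?mulr_ge0//.
by rewrite ler_wpM2r// invr_ge0 sqr_ge0.
Qed.

(** Both sides depend on the partition only through W, so the mesh condition is met by refining. *)
Lemma stein_step_integral n (t c : nat -> R) : nondecreasing_seq t ->
  (forall i, `|c i| <= eta) ->
  let W := step_integral L n t c in
  (`|Ex P (fun w => W w * h (W w)) -
    Ex P (fun w => W w ^+ 2) * Ex P (fun w => dh (W w))| <=
  Ex P (fun w => W w ^+ 2) * (2 * m + 2 * B * (eta ^+ 2 / e ^+ 2) + 16 * B * q) : Prop).
Proof.
move=> ndt ceta W.
(* Each interval is no longer than t n - t 0 <= r, so its r equal pieces have length at most 1. *)
pose r := (Num.bound (t n - t 0)).+1.
have tn0 : 0 <= t n - t 0 by rewrite subr_ge0 ndt.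
have := @stein_step_integral_mesh1 (n * r) (refined r t) (fun k => c (k %/ r)%N)
  (refined_nondecreasing (ltn0Sn _) ndt).
have WE : step_integral L (n * r) (refined r t) (fun k => c (k %/ r)%N) = W.
  by apply/funext => w; exact: refined_step_integral.
rewrite WE; apply => // i ilt.
have ir : (i %/ r < n)%N by rewrite ltn_divLR.
rewrite addrC -lerBlDr refinedB// ler_pdivrMr ?ltr0n// mul1r.
have tr : t n - t 0 <= r%:R.
  by rewrite -natr1 ler_wpDr// ltW// archi_boundP.
apply: le_trans tr; apply: lerB; exact: ndt.
Qed.

End StepIntegral.

(** * Clipped step functions *)

Section Clip.
Context (R : realType).
Implicit Types eta x y : R.

Definition clip eta x : R :=
  if eta < x then eta else if x < - eta then - eta else x.

Lemma clip0 eta : 0 <= eta -> clip eta 0 = 0.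
Proof. by move=> e0; rewrite /clip; case: ltP => ?; [lra|case: ltP => ?; lra]. Qed.

Lemma normr_clip eta x : 0 <= eta -> `|clip eta x| <= eta.
Proof.
move=> e0; rewrite /clip ler_norml; apply/andP.
by case: ltP => ?; [|case: ltP => ?]; split; lra.
Qed.

Let ler_dist_cases (a b x y : R) : (x <= y -> x - y <= a - b <= y - x) ->
  (y <= x -> y - x <= a - b <= x - y) -> `|a - b| <= `|y - x|.
Proof.
move=> h1 h2; have [xy|/ltW xy] := leP x y.
  by rewrite (ger0_norm (x := y - x)) ?subr_ge0// ler_norml opprB h1.
by rewrite (ler0_norm (x := y - x)) ?subr_le0// ler_norml opprK opprB h2.
Qed.

(** The clipped value and the residue x - clip eta x are both nondecreasing in x and add up to x, so
    each of them is 1-Lipschitz. *)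
Lemma clip_lipschitz eta x y : 0 <= eta -> `|clip eta y - clip eta x| <= `|y - x|.
Proof.
by move=> e0; apply: ler_dist_cases => xy; apply/andP; rewrite /clip;
  case: (ltP eta x) => ?; case: (ltP eta y) => ?;
  try (case: (ltP x) => ?); try (case: (ltP y) => ?); split; lra.
Qed.

Lemma sub_clip_lipschitz eta x y : 0 <= eta ->
  `|(y - clip eta y) - (x - clip eta x)| <= `|y - x|.
Proof.
by move=> e0; apply: ler_dist_cases => xy; apply/andP; rewrite /clip;
  case: (ltP eta x) => ?; case: (ltP eta y) => ?;
  try (case: (ltP x) => ?); try (case: (ltP y) => ?); split; lra.
Qed.

Lemma sqr_sub_clip eta x : 0 <= eta ->
  (x - clip eta x) ^+ 2 <= x ^+ 2 * outside eta x.
Proof.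
move=> e0; rewrite /outside; case: ltP => [ex|xe]; rewrite /= ?mulr1 ?mulr0.
  rewrite -real_normK ?num_real// -[leRHS]real_normK ?num_real//.
  rewrite lerXn2r ?nnegrE//.
  by have := @sub_clip_lipschitz eta 0 x e0; rewrite clip0// !subr0.
move: xe; rewrite ler_norml /clip => /andP[? ?].
rewrite ltNge (_ : x <= eta)//= ltNge (_ : - eta <= x)//=.
by rewrite subrr expr0n.
Qed.

Lemma sqrrD_le x y : (x + y) ^+ 2 <= 2 * x ^+ 2 + 2 * y ^+ 2.
Proof. by rewrite -subr_ge0; have := sqr_ge0 (x - y); rewrite !expr2; lra. Qed.

(** Meant for x a value of f and y a value of an approximating step function: no bound on y is
    available, so the part of y removed by clipping is estimated through its distance to x and the
    tail of x. *)
Lemma sqr_sub_clip_le eta x y : 0 <= eta ->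
  (y - clip eta y) ^+ 2 <= 2 * (x - y) ^+ 2 + 2 * (x ^+ 2 * outside eta x).
Proof.
move=> e0.
rewrite -[y - clip eta y](subrK (x - clip eta x)).
apply: le_trans (sqrrD_le _ _) (lerD _ _); rewrite ler_wpM2l//; last exact: sqr_sub_clip.
rewrite -real_normK ?num_real// -[leRHS]real_normK ?num_real// [`|x - y|]distrC.
by rewrite lerXn2r ?nnegrE// sub_clip_lipschitz.
Qed.

Lemma sqr_clip_sub_le eta x y : 0 <= eta ->
  (clip eta y - x) ^+ 2 <= 2 * (x - y) ^+ 2 + 2 * (x ^+ 2 * outside eta x).
Proof.
move=> e0.
rewrite -[clip eta y](subrK (clip eta x)) -addrA.
apply: le_trans (sqrrD_le _ _) (lerD _ _); rewrite ler_wpM2l//.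
  rewrite -real_normK ?num_real// -[leRHS]real_normK ?num_real//.
  by rewrite lerXn2r ?nnegrE// [`|x - y|]distrC clip_lipschitz.
by rewrite -sqrrN opprB sqr_sub_clip.
Qed.

End Clip.

(** * Effect of clipping on the L^2 norm of a step function *)

Section StepFunctions.
Context (R : realType).
Local Notation mu := (@lebesgue_measure R).
Implicit Types (f : R -> R) (t c : nat -> R).

(** The half-open intervals of a nondecreasing [t] are disjoint, so at most one summand is nonzero;
    phi 0 = 0 takes care of the points outside all of them. *)
Lemma step_fun_comp (phi : R -> R) n t c s : phi 0 = 0 -> nondecreasing_seq t ->
  phi (step_fun n t c s) = step_fun n t (phi \o c) s.
Proof.
move=> phi0 ndt; rewrite /step_fun.
have [[i si]|nos] := pselect (exists i : 'I_n, `]t i, t i.+1]%classic s).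
  have other j : j != i -> \1_(`]t j, t j.+1]%classic) s = 0 :> R.
    move=> ji; rewrite indicE memNset// => sj.
    move: si sj; rewrite /= !in_itv/= => /andP[a1 a2] /andP[b1 b2].
    move: ji; rewrite -val_eqE neq_ltn => /orP[ij|ij].
      by have := lt_le_trans a1 (le_trans b2 (ndt _ _ ij)); rewrite ltxx.
    by have := lt_le_trans b1 (le_trans a2 (ndt _ _ ij)); rewrite ltxx.
  rewrite (bigD1 i)//= big1 ?addr0 => [|j ji]; last by rewrite other ?mulr0.
  rewrite (bigD1 i)//= big1 ?addr0 => [|j ji]; last by rewrite other ?mulr0.
  by rewrite indicE mem_set// !mulr1.
rewrite big1 => [|i _]; first rewrite big1 => [|i _]//.
- by rewrite indicE memNset ?mulr0// => si; apply: nos; exists i.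
- by rewrite indicE memNset ?mulr0// => si; apply: nos; exists i.
Qed.

Lemma measurable_step_fun n t c : measurable_fun setT (step_fun n t c).
Proof. by apply: measurable_sum => i; apply: measurable_funM. Qed.

Lemma integral_step_fun n t c : nondecreasing_seq t -> (forall i, 0 <= c i) ->
  (\int[mu]_s (step_fun n t c s)%:E = (\sum_(i < n) c i * (t i.+1 - t i))%:E)%E.
Proof.
move=> ndt c0; rewrite /step_fun -sumEFin.
under eq_integral do rewrite -sumEFin.
have mI (i : nat) : measurable_fun setT
    (fun s => (\1_(`]t i, t i.+1]%classic) s)%:E : \bar R).
  by apply/measurable_EFinP; exact: measurable_indic.
have I0 (i : nat) s : (0 <= (\1_(`]t i, t i.+1]%classic) s)%:E :> \bar R)%E.
  by rewrite lee_fin.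
have c0' i : (0 <= (c i)%:E)%E by rewrite lee_fin.
have mcI (i : nat) : measurable_fun setT
    (fun s => (c i * \1_(`]t i, t i.+1]%classic) s)%:E : \bar R).
  by under eq_fun do rewrite EFinM; exact: measurable_funeM.
have cI0 (i : nat) s : (0 <= (c i * \1_(`]t i, t i.+1]%classic) s)%:E :> \bar R)%E.
  by rewrite lee_fin mulr_ge0.
rewrite ge0_integral_sum//; last by move=> i; exact: mcI.
apply: eq_bigr => i _; under eq_integral do rewrite EFinM.
rewrite ge0_integralZl//; last exact: mI.
rewrite integral_indic//= setIT lebesgue_measure_itv/= lte_fin EFinM.
have := ndt _ _ (leqnSn i); rewrite le_eqVlt => /predU1P[->|->].
  by rewrite ltxx subrr.

by rewrite -EFinB.
Qed.

Variables (f : R -> R) (n : nat) (t c : nat -> R) (eta eps tau F : R).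
Hypothesis mf : measurable_fun setT f.
Hypothesis ndt : nondecreasing_seq t.
Hypothesis eta0 : 0 <= eta.
Hypothesis feps : (\int[mu]_s ((f s - step_fun n t c s) ^+ 2)%:E <= eps%:E)%E.
Hypothesis ftau : (\int[mu]_(s in [set s | (eta < `|f s|)%R]) (f s ^+ 2)%:E <= tau%:E)%E.
Hypothesis fF : (\int[mu]_s (f s ^+ 2)%:E = F%:E)%E.

Let g := step_fun n t c.
Let mg : measurable_fun setT g. Proof. exact: measurable_step_fun. Qed.

Let ftau' : (\int[mu]_s (f s ^+ 2 * outside eta (f s))%:E <= tau%:E)%E.
Proof.
apply: le_trans ftau; rewrite [leRHS]integral_mkcond.
rewrite le_eqVlt; apply/orP; left; apply/eqP; apply: eq_integral => s _.
rewrite patchE /outside; case: ifPn => [|].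
  by rewrite inE/= => ->; rewrite mulr1.
by move=> /negP; rewrite inE/= => /negP/negbTE ->; rewrite mulr0.
Qed.

Let mout : measurable_fun setT (fun s => f s ^+ 2 * outside eta (f s)).
Proof.
apply: measurable_funM; first exact: measurable_funX.
by apply: measurableT_comp => //; exact: measurable_outside.
Qed.

Let mfg : measurable_fun setT (fun s => (f s - g s) ^+ 2).
Proof. by apply: measurable_funX; exact: measurable_funB. Qed.

Let rho_bound (u : R -> R) : measurable_fun setT u -> (forall s, 0 <= u s) ->
  (forall s, u s <= 2 * (f s - g s) ^+ 2 + 2 * (f s ^+ 2 * outside eta (f s))) ->
  (\int[mu]_s (u s)%:E <= (2 * eps + 2 * tau)%:E)%E.
Proof.
move=> mu' u0 ule.
have o0 s : 0 <= f s ^+ 2 * outside eta (f s).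
  by apply: mulr_ge0; [exact: sqr_ge0|exact: outside_ge0].
have mU : measurable_fun setT (fun s => (u s)%:E) by exact/measurable_EFinP.
have m1 : measurable_fun setT (fun s => ((f s - g s) ^+ 2)%:E) by exact/measurable_EFinP.
have m2 : measurable_fun setT (fun s => (f s ^+ 2 * outside eta (f s))%:E).
  exact/measurable_EFinP.
have m12 : measurable_fun setT (fun s => 2%:E * ((f s - g s) ^+ 2)%:E +
    2%:E * (f s ^+ 2 * outside eta (f s))%:E)%E.
  by apply: emeasurable_funD; exact: measurable_funeM.
have n1 s : (0 <= ((f s - g s) ^+ 2)%:E)%E by rewrite lee_fin sqr_ge0.
have n2 s : (0 <= (f s ^+ 2 * outside eta (f s))%:E)%E by rewrite lee_fin.
apply: (@le_trans _ _ (\int[mu]_s (2%:E * ((f s - g s) ^+ 2)%:E +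
    2%:E * (f s ^+ 2 * outside eta (f s))%:E))%E).
  apply: ge0_le_integral => //.
  - by move=> s _; rewrite lee_fin.
  - by move=> s _; rewrite -!EFinM -EFinD lee_fin.
rewrite ge0_integralD//; first last.
- exact: measurable_funeM.
- by move=> s _; rewrite mule_ge0.
- exact: measurable_funeM.
- by move=> s _; rewrite mule_ge0.
rewrite (ge0_integralZl mu measurableT m1)// (ge0_integralZl mu measurableT m2)//.
by rewrite (EFinD (2 * eps)) (EFinM 2 eps) (EFinM 2 tau) leeD// lee_pmul2l.
Qed.

Let measurable_clip : measurable_fun setT (fun s => clip eta (g s)).
Proof.
rewrite (_ : (fun s => _) = step_fun n t (clip eta \o c)).
  exact: measurable_step_fun.
by apply/funext => s; rewrite step_fun_comp// clip0.
Qed.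

Let sum_sqr (phi : R -> R) : phi 0 = 0 ->
  (\int[mu]_s (phi (g s) ^+ 2)%:E = (\sum_(i < n) phi (c i) ^+ 2 * (t i.+1 - t i))%:E)%E.
Proof.
move=> phi0; rewrite -(@integral_step_fun n t (fun i => phi (c i) ^+ 2))//; last first.
  by move=> i; exact: sqr_ge0.
apply: eq_integral => s _; congr EFin.
by rewrite (step_fun_comp (phi := fun x => phi x ^+ 2))// phi0 expr0n.
Qed.

(** By the isometry this sum is the squared L^2 distance between the step integral and its clipped
    version. *)
Lemma step_fun_sub_clip :
  \sum_(i < n) (c i - clip eta (c i)) ^+ 2 * (t i.+1 - t i) <= 2 * eps + 2 * tau.
Proof.
rewrite -lee_fin -(sum_sqr (phi := fun x => x - clip eta x)); last first.
  by rewrite clip0// subrr.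
apply: rho_bound.
- by apply: measurable_funX; exact: measurable_funB.
- by move=> s; exact: sqr_ge0.
- by move=> s; exact: sqr_sub_clip_le.
Qed.

(** Young's inequality with weight [a], applied to 2 x (y - x), gives |y ^+ 2 - x ^+ 2| <= a x ^+ 2
    + (1 + 1 / a) (y - x) ^+ 2. A small [a] is fixed first, then [eps] and [tau] are taken small
    compared with it. *)
Lemma step_fun_clip_norm (a : R) : 0 < a ->
  `|\sum_(i < n) clip eta (c i) ^+ 2 * (t i.+1 - t i) - F| <=
  a * F + (1 + a^-1) * (2 * eps + 2 * tau).
Proof.
move=> a0; set V := \sum_(i < n) _.
have VE : (\int[mu]_s (clip eta (g s) ^+ 2)%:E = V%:E)%E.
  by rewrite sum_sqr ?clip0.
pose D s := (clip eta (g s) - f s) ^+ 2.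
have mD : measurable_fun setT D by apply: measurable_funX; exact: measurable_funB.
have iD : (\int[mu]_s (D s)%:E <= (2 * eps + 2 * tau)%:E)%E.
  apply: rho_bound => // s; first exact: sqr_ge0.
  exact: sqr_clip_sub_le.
have D0 s : 0 <= D s by exact: sqr_ge0.
have a1 : 0 <= 1 + a^-1 by rewrite addr_ge0// invr_ge0 ltW.
have mf2 : measurable_fun setT (fun s => f s ^+ 2) by exact: measurable_funX.
have key s : `|clip eta (g s) ^+ 2 - f s ^+ 2| <= a * f s ^+ 2 + (1 + a^-1) * D s.
  rewrite /D; set x := f s; set y := clip eta (g s).
  have p1 : 0 <= a^-1 * (a * x + (y - x)) ^+ 2.
    by rewrite mulr_ge0 ?sqr_ge0// invr_ge0 ltW.
  have p2 : 0 <= a^-1 * (a * x - (y - x)) ^+ 2.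
    by rewrite mulr_ge0 ?sqr_ge0// invr_ge0 ltW.
  have E1 : a^-1 * (a * x + (y - x)) ^+ 2 =
      a * x ^+ 2 + 2 * x * (y - x) + a^-1 * (y - x) ^+ 2.
    by field; rewrite gt_eqF.
  have E2 : a^-1 * (a * x - (y - x)) ^+ 2 =
      a * x ^+ 2 - 2 * x * (y - x) + a^-1 * (y - x) ^+ 2.
    by field; rewrite gt_eqF.
  have E3 : y ^+ 2 - x ^+ 2 = 2 * x * (y - x) + (y - x) ^+ 2 by ring.
  have p3 : 0 <= (y - x) ^+ 2 by exact: sqr_ge0.
  rewrite E3 mulrDl mul1r ler_norml; apply/andP; split; lra.
(* Each half of the absolute value is a comparison of integrals of nonnegative functions, which
   avoids subtraction in the extended reals. *)
have le3 (x y : R -> R) (b b' : R) : measurable_fun setT x -> (forall s, 0 <= x s) ->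
    measurable_fun setT y -> (forall s, 0 <= y s) ->
    (forall s, x s <= y s + a * f s ^+ 2 + (1 + a^-1) * D s) ->
    (\int[mu]_s (x s)%:E = b%:E)%E -> (\int[mu]_s (y s)%:E = b'%:E)%E ->
    b <= b' + (a * F + (1 + a^-1) * (2 * eps + 2 * tau)).
  move=> mx x0 my y0 xle xb yb.
  have mxE : measurable_fun setT (fun s => (x s)%:E) by exact/measurable_EFinP.
  have myE : measurable_fun setT (fun s => (y s)%:E) by exact/measurable_EFinP.
  have mfE : measurable_fun setT (fun s => (f s ^+ 2)%:E) by exact/measurable_EFinP.
  have mDE : measurable_fun setT (fun s => (D s)%:E) by exact/measurable_EFinP.
  have mafE : measurable_fun setT (fun s => a%:E * (f s ^+ 2)%:E)%E.
    exact: measurable_funeM.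
  have maDE : measurable_fun setT (fun s => (1 + a^-1)%:E * (D s)%:E)%E.
    exact: measurable_funeM.
  have f0 s : (0 <= (f s ^+ 2)%:E)%E by rewrite lee_fin sqr_ge0.
  have af0 s : (0 <= a%:E * (f s ^+ 2)%:E)%E by rewrite mule_ge0// lee_fin ltW.
  have D0E s : (0 <= (D s)%:E)%E by rewrite lee_fin.
  have aD0 s : (0 <= (1 + a^-1)%:E * (D s)%:E)%E by rewrite mule_ge0.
  have y0E s : (0 <= (y s)%:E)%E by rewrite lee_fin.
  have x0E s : (0 <= (x s)%:E)%E by rewrite lee_fin.
  have mafD := emeasurable_funD mafE maDE.
  have afD0 s : (0 <= a%:E * (f s ^+ 2)%:E + (1 + a^-1)%:E * (D s)%:E)%E.
    by rewrite adde_ge0.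
  have : (\int[mu]_s (x s)%:E <= \int[mu]_s ((y s)%:E +
      (a%:E * (f s ^+ 2)%:E + (1 + a^-1)%:E * (D s)%:E)))%E.
    have m2 := emeasurable_funD myE mafD.
    apply: ge0_le_integral => //.
    by move=> s _; rewrite -!EFinM -!EFinD lee_fin addrA.
  rewrite (ge0_integralD mu measurableT (fun s _ => y0E s) myE (fun s _ => afD0 s) mafD).
  rewrite (ge0_integralD mu measurableT (fun s _ => af0 s) mafE (fun s _ => aD0 s) maDE).
  rewrite (ge0_integralZl mu measurableT mfE)//; last by rewrite lee_fin ltW.
  rewrite (ge0_integralZl mu measurableT mDE)// xb yb fF => xint.
  have : (b%:E <= b'%:E + (a%:E * F%:E + (1 + a^-1)%:E * (2 * eps + 2 * tau)%:E))%E.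
    apply: le_trans xint _; rewrite leeD2l// leeD2l//.
    by rewrite lee_wpmul2l.
  by rewrite -!EFinM -!EFinD lee_fin.
rewrite ler_distl; apply/andP; split.
  rewrite lerBlDr; apply: (le3 (fun s => f s ^+ 2) (fun s => clip eta (g s) ^+ 2)) => //.
  - by move=> s; exact: sqr_ge0.
  - exact: measurable_funX.
  - by move=> s; exact: sqr_ge0.
  - by move=> s; have := key s; rewrite ler_norml; lra.
apply: (le3 (fun s => clip eta (g s) ^+ 2) (fun s => f s ^+ 2)) => //.
- exact: measurable_funX.
- by move=> s; exact: sqr_ge0.
- by move=> s; exact: sqr_ge0.
- by move=> s; have := key s; rewrite ler_norml; lra.
Qed.

End StepFunctions.

(** * The Stein equation of the normal law *)

Section NormalDensity.
Context (R : realType).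
Local Notation mu := (@lebesgue_measure R).
Local Notation p := (@normal_pdf R 0 1).

Lemma normal_pdf01E (x : R) : p x = normal_peak 1 * expR (- (x ^+ 2 / 2)).
Proof. by rewrite normal_pdfE ?oner_neq0// /normal_fun subr0 expr1n mulNr. Qed.

Lemma normal_pdf01_gt0 (x : R) : 0 < p x.
Proof. by rewrite normal_pdf01E mulr_gt0 ?expR_gt0 ?normal_peak_gt0// oner_neq0. Qed.

Lemma is_derive_normal_pdf01 (x : R) : is_derive x (1 : R) p (- x * p x).
Proof.
have scaleE (a b : R) : a *: b = a * b by [].
pose e (y : R) : R := - (y ^+ 2 / 2).
have de : is_derive x (1 : R) e (- x).
  have -> : e = (- 2^-1) \*: (id ^+ 2 : R -> R).
    by apply/funext => y; rewrite /e exprfctE /= scaleE; field.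
  apply: is_derive_eq; by rewrite !scaleE /= expr1; field.
have -> : p = normal_peak 1 \*: (expR \o e).
  by apply/funext => y; rewrite normal_pdf01E /= scaleE.
apply: is_derive_eq.
by rewrite /= !scaleE; ring.
Qed.

Lemma continuous_normal_pdf01 : continuous p.
Proof. by apply: continuous_normal_pdf; exact: oner_neq0. Qed.

(** The Radon-Nikodym derivative of the normal law has the same integrals over measurable sets as
    [normal_pdf], hence equals it almost everywhere. *)
Lemma integral_normal_prob01 (g : R -> R) (M : R) : continuous g ->
  (forall x, `|g x| <= M) ->
  (\int[normal_prob 0 1]_x (g x)%:E = \int[mu]_x (g x * p x)%:E)%E.
Proof.
move=> cg gM.
have mg : measurable_fun setT g by exact: continuous_measurable_fun.
have ig : (normal_prob 0 1).-integrable setT (EFin \o g).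
  apply: measurable_bounded_integrable => //.
    by rewrite (le_lt_trans (probability_le1 _ _)) ?ltry.
  exists M; split; first exact: num_real.
  by move=> y My x _; exact: le_trans (gM x) (ltW My).
rewrite -(Radon_Nikodym_change_of_variables (normal_prob_dominates 0 1))//.
have mpdf := @measurable_normal_pdf R 0 1.
apply: ae_eq_integral => //.
- apply: emeasurable_funM; first exact/measurable_EFinP.
  apply: (measurable_int mu).
  by apply: Radon_Nikodym_integrable; exact: normal_prob_dominates.
- by apply/measurable_EFinP; exact: measurable_funM.
rewrite /=.
under [X in ae_eq _ _ _ X]eq_fun do rewrite EFinM.
apply: ae_eqe_mul2l => /=.
rewrite Radon_NikodymE//=; first exact: normal_prob_dominates.
move=> dom; case: cid => /= h [h1 h2 h3].
apply: integral_ae_eq => //=.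
by apply/measurable_EFinP; exact: measurable_normal_pdf.
by move=> E _ mE; rewrite -h3.
Qed.
End NormalDensity.

(** * Gaussian tail bounds *)

Section MillsRatio.
Context (R : realType).
Local Notation mu := (@lebesgue_measure R).
Local Notation p := (@normal_pdf R 0 1).

Lemma normal_pdf01_cvgy : p x @[x --> +oo] --> 0.
Proof.
rewrite (_ : p = fun x => normal_peak 1 * expR (- (x ^+ 2 / 2))); last first.
  by apply/funext => y; exact: normal_pdf01E.
rewrite -[X in _ --> X](mulr0 (normal_peak 1)); apply: cvgMr.
apply: (cvg_comp (fun x : R => x ^+ 2 / 2) (fun x => expR (- x))); last exact: cvgr_expR.
by apply: gt0_cvgMly; [rewrite invr_gt0|exact: cvgr_expr2].
Qed.

Lemma normal_pdf01N (x : R) : p (- x) = p x.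
Proof. by rewrite !normal_pdf01E sqrrN. Qed.

(** For y >= x >= 1 one has p y <= y p y, and y p y is the derivative of - p, which vanishes at
    infinity. *)
Lemma normal_pdf01_right_tail (x : R) : 1 <= x ->
  (\int[mu]_(y in `[x, +oo[) (p y)%:E <= (p x)%:E)%E.
Proof.
move=> x1.
have cyp : continuous (fun y : R => y * p y).
  by move=> y; apply: cvgM; [exact: cvg_id|exact: continuous_normal_pdf01].
have dNp (y : R) : is_derive y (1 : R) (fun z => - p z) (y * p y).
  have := is_deriveN (is_derive_normal_pdf01 y).
  by rewrite mulNr opprK.
apply: (@le_trans _ _ (\int[mu]_(y in `[x, +oo[) (y * p y)%:E)%E).
  apply: ge0_le_integral => //.
  - by move=> y _; rewrite lee_fin normal_pdf_ge0.
  - apply/measurable_EFinP; apply: measurable_funTS.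
    exact: measurable_normal_pdf.
  - by apply/measurable_EFinP; apply: measurable_funTS; exact: continuous_measurable_fun.
  - move=> y; rewrite /= in_itv/= andbT => xy.
    by rewrite lee_fin ler_peMl ?normal_pdf_ge0// (le_trans x1).
rewrite (@ge0_continuous_FTC2y _ _ (fun z => - p z) _ 0).
- by rewrite sub0e EFinN oppeK.
- by move=> y xy; rewrite mulr_ge0 ?normal_pdf_ge0//; lra.
- exact: continuous_subspaceT.
- by rewrite -[X in _ --> X]oppr0; apply: cvgN; exact: normal_pdf01_cvgy.
- by move=> y _; have [] := dNp y.
- apply: cvg_at_right_filter; apply: cvgN; exact: continuous_normal_pdf01.
- by move=> y _; rewrite derive1E; have [_ ->] := dNp y.
Qed.

Lemma normal_pdf01_left_tail (x : R) : x <= - 1 ->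
  (\int[mu]_(y in `]-oo, x]) (p y)%:E <= (p x)%:E)%E.
Proof.
move=> x1; rewrite -[x]opprK ge0_integration_by_substitutionNy.
- rewrite normal_pdf01N; apply: le_trans (normal_pdf01_right_tail _); last by lra.
  under eq_integral do rewrite /= normal_pdf01N.
  exact: lexx.
- exact/continuous_subspaceT/continuous_normal_pdf01.
- by move=> y _; exact: normal_pdf_ge0.
Qed.

End MillsRatio.

(** * A bounded solution of Stein's equation *)

Section SteinSolution.
Context (R : realType).
Local Notation mu := (@lebesgue_measure R).
Local Notation p := (@normal_pdf R 0 1).
Variables (g : R -> R) (M c : R).
Hypothesis cg : continuous g.
Hypothesis gM : forall x, `|g x| <= M.
Hypothesis gc : (\int[normal_prob 0 1]_x (g x)%:E = c%:E)%E.

Let M0 : 0 <= M. Proof. exact: le_trans (gM 0). Qed.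

Let phi x := (g x - c) * p x.

Let p0 x : 0 <= p x. Proof. exact/ltW/normal_pdf01_gt0. Qed.

Let cphi : continuous phi.
Proof.
move=> x; apply: cvgM; last exact: continuous_normal_pdf01.
by apply: cvgB; [exact: cg|exact: cvg_cst].
Qed.

Let ip : mu.-integrable setT (EFin \o p). Proof. exact: integrable_normal_pdf. Qed.

Let mgp : measurable_fun setT (fun x => g x * p x).
Proof.
apply: measurable_funM; first exact: continuous_measurable_fun.
exact: measurable_normal_pdf.
Qed.

Let igp : mu.-integrable setT (EFin \o (fun x => g x * p x)).
Proof.
apply: (le_integrable measurableT _ _ (integrableZl measurableT M ip)).
  exact/measurable_EFinP.
move=> x _ /=; rewrite lee_fin !normrM.
by rewrite ler_wpM2r// (le_trans (gM x))// ler_norm.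
Qed.

Let gcE : \int[mu]_x (g x * p x) = c.
Proof.
by rewrite /Rintegral -(integral_normal_prob01 cg gM) gc.
Qed.

Let intp : \int[mu]_x p x = 1.
Proof. by rewrite /Rintegral integral_normal_pdf. Qed.

Let iphi : mu.-integrable setT (EFin \o phi).
Proof.
have := integrableB measurableT igp (integrableZl measurableT c ip).
by apply: eq_integrable => // x _ /=; rewrite /phi mulrBl EFinB EFinM.
Qed.

Let phi_int0 : \int[mu]_x phi x = 0.
Proof.
rewrite (_ : phi = fun x => g x * p x - c * p x); last first.
  by apply/funext => x; rewrite /phi mulrBl.
rewrite RintegralB//; last exact: (integrableZl measurableT c ip).
by rewrite gcE RintegralZl// intp mulr1 subrr.
Qed.

Let cM : `|c| <= M.
Proof.
rewrite -gcE; apply: le_trans (le_normr_Rintegral _ _) _ => //.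
rewrite -[leRHS]mulr1 -[X in _ <= _ * X]intp -RintegralZl//; apply: le_Rintegral => //.
exact: integrable_norm igp.
- exact: (integrableZl measurableT M ip).
- by move=> x _; rewrite normrM (ger0_norm (p0 x)) ler_wpM2r.
Qed.

Let phiM x : `|phi x| <= 2 * M * p x.
Proof.
rewrite normrM (ger0_norm (p0 x)) ler_wpM2r//.
by rewrite (le_trans (ler_normB _ _))// (le_trans (lerD (gM x) cM))//; lra.
Qed.

Let phi_set_le (A : set R) (b : R) : measurable A ->
  (\int[mu]_(x in A) (p x)%:E <= b%:E)%E -> `|\int[mu]_(x in A) phi x| <= 2 * M * b.
Proof.
move=> mA pb.
have iA (f : R -> R) : mu.-integrable setT (EFin \o f) -> mu.-integrable A (EFin \o f).
  exact: integrableS.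
have ipA := iA _ ip.
apply: le_trans (le_normr_Rintegral _ (iA _ iphi)) _ => //.
apply: (@le_trans _ _ (\int[mu]_(x in A) (2 * M * p x))).
  apply: le_Rintegral => //.
  - exact: integrable_norm (iA _ iphi).
  - exact: iA (integrableZl measurableT (2 * M) ip).
rewrite RintegralZl// ler_wpM2l ?mulr_ge0// /Rintegral.
by rewrite -lee_fin fineK//; exact: integrable_fin_num.
Qed.

Let G x := \int[mu]_(y in `]-oo, x]) phi y.

Let derive_G x : is_derive x (1 : R) G (phi x).
Proof.
have iNy : mu.-integrable [set` Interval -oo%O (BRight (x + 1))] (EFin \o phi).
  exact: integrableS iphi.
have xx1 : x < x + 1 by rewrite ltrDl.
have cx : {for x, continuous phi} by exact: cphi.
have [|dG dGE] := @continuous_FTC1 R phi -oo%O x (x + 1) xx1 iNy _ cx.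
  by rewrite ltNyr.
by apply: DeriveDef => //; rewrite -derive1E.
Qed.

Let G_le1 x : `|G x| <= 2 * M.
Proof.
rewrite -[leRHS]mulr1; apply: phi_set_le => //.
rewrite -(integral_normal_pdf (0 : R) 1); apply: ge0_subset_integral => //.
  by apply/measurable_EFinP; exact: measurable_normal_pdf.
by move=> y _; rewrite lee_fin.
Qed.

Let G_left x : x <= - 1 -> `|G x| <= 2 * M * p x.
Proof. by move=> x1; apply: phi_set_le => //; exact: normal_pdf01_left_tail. Qed.

(** Since phi has total integral 0, G x is minus the integral of phi over the right tail, where the
    Gaussian tail bound applies. *)
Let G_right x : 1 <= x -> `|G x| <= 2 * M * p x.
Proof.
move=> x1.
have -> : G x = - \int[mu]_(y in `]x, +oo[) phi y.
  apply/eqP; rewrite -addr_eq0; apply/eqP; rewrite -phi_int0 /G -Rintegral_setU//.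
  - by congr (Rintegral _ _ _); rewrite -setCitvl setUv.
  - by rewrite -setCitvl setUv.
  - by rewrite -setCitvl; apply/disj_setPS => y [].
rewrite normrN; apply: phi_set_le => //.
apply: le_trans (normal_pdf01_right_tail x1).
apply: ge0_subset_integral => //.
- by apply/measurable_EFinP/measurable_funTS; exact: measurable_normal_pdf.
- by move=> y _; rewrite lee_fin.
- by move=> y; rewrite /= !in_itv/= !andbT; exact: ltW.
Qed.

(* Since p' = - x p, variation of constants solves h' - x h = g - c; the choice of c
   makes G vanish at both ends, hence h bounded. *)
Definition stein_solution x := G x / p x.

Lemma stein_solutionP x :
  is_derive x (1 : R) stein_solution (x * stein_solution x + (g x - c)).
Proof.
have px : p x != 0 by rewrite gt_eqF// normal_pdf01_gt0.
have scaleE (a b : R) : a *: b = a * b by [].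
have dV := is_deriveV px (is_derive_normal_pdf01 x).
rewrite {2}/stein_solution.
have -> : stein_solution = (G * (fun y => (p y)^-1) : R -> R) by apply/funext.
apply: is_derive_eq (is_deriveM (derive_G x) dV) _.
rewrite !scaleE /phi.
by field.
Qed.

(** Outside ]-1, 1[ the tail bounds give |G| <= 2 M p. Inside, |G| <= 2 M and p x >= p 1 give 2 M /
    p 1. The constant covers both. *)
Lemma stein_solution_bounded : exists B : R, forall x, `|stein_solution x| <= B.
Proof.
exists (2 * M * (1 + (p 1)^-1)) => x.
rewrite normrM normfV (ger0_norm (p0 x)) ler_pdivrMr ?normal_pdf01_gt0//.
have p1 : 0 < p 1 by exact: normal_pdf01_gt0.
have MM : 0 <= 2 * M by rewrite mulr_ge0.
have large : 2 * M * p x <= 2 * M * (1 + (p 1)^-1) * p x.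
  by rewrite ler_wpM2r// ler_peMr// lerDl invr_ge0 ltW.
have [x1|x1] := leP x (- 1); first exact: le_trans (G_left x1) large.
have [x2|x2] := leP 1 x; first exact: le_trans (G_right x2) large.
apply: le_trans (G_le1 x) _; rewrite -(mulrA (2 * M)) ler_peMr//.
have pp : p 1 <= p x.
  rewrite !normal_pdf01E ler_wpM2l ?normal_peak_ge0// ler_expR lerN2.
  rewrite ler_wpM2r ?invr_ge0// expr1n expr2; nra.
have : 1 <= (p 1)^-1 * p x by rewrite mulrC ler_pdivlMr// mul1r.
have := p0 x; rewrite mulrDl mul1r; lra.
Qed.

End SteinSolution.

(** * Continuous functions decaying at infinity *)

Section VanishingFunctions.
Context (R : realType).
Implicit Types v : R -> R.

Definition uniformly_continuous v := forall e : R, 0 < e ->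
  exists2 r : R, 0 < r & forall x y, `|x - y| <= r -> `|v x - v y| <= e.

(** Heine's theorem with [y] free to leave [K], so that pairs straddling the boundary of [K] need no
    separate treatment. *)
Lemma compact_uniformly_continuous v (K : set R) (e : R) : continuous v ->
  compact K -> 0 < e ->
  exists2 r : R, 0 < r & forall x y, K x -> `|x - y| <= r -> `|v x - v y| <= e.
Proof.
move=> cv /compact_near_coveringP cK e0.
have : \forall r \near 0^'+, K `<=` (fun x => forall y, `|x - y| <= r -> `|v x - v y| <= e).
  apply: (cK R (0^'+) (fun r x => forall y, `|x - y| <= r -> `|v x - v y| <= e)).
  move=> x Kx.
  have e2 : 0 < e / 2 by rewrite divr_gt0.
  have /cvgrPdist_le /(_ _ e2) [r /= r0 vr] := cv x.
  exists (ball x (r / 2), [set z | 0 < z < r / 2]).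
    split; first by apply: nbhsx_ballx; rewrite divr_gt0.
    by near=> z => /=; apply/andP; split; near: z;
      [exact: nbhs_right_gt|apply: nbhs_right_lt; rewrite divr_gt0].
  move=> [x' z] /= [xx' /andP[z0 zr]] y x'y.
  have h1 : `|v x - v x'| <= e / 2.
    by apply: vr => /=; move: xx'; rewrite /ball/=; lra.
  have h2 : `|v x - v y| <= e / 2.
    apply: vr => /=; rewrite -(subrKA x').
    by apply: le_lt_trans (ler_normD _ _) _; move: xx'; rewrite /ball/=; lra.
  rewrite -(subrKA (v x)) (le_trans (ler_normD _ _))// [`|v x' - _|]distrC; lra.
move=> H.
have [r [Kr r0]] := filter_ex (filterI H (nbhs_right_gt (0 : R))).
exists r => // x y Kx; exact: Kr.
Unshelve. all: by end_near. Qed.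

(** A quantitative decay at infinity; the rate 1 / |x| is the one that the damping below
    produces. *)
Definition vanishing v := exists C : R, forall x, 1 <= `|x| -> `|v x| <= C / `|x|.

Lemma vanishing_bounded v : continuous v -> vanishing v ->
  exists B : R, forall x, `|v x| <= B.
Proof.
move=> cv [C vC].
have C0 : 0 <= C.
  by have := vC 1; rewrite normr1 divr1 lexx => /(_ isT); exact: le_trans.
have cnv : {within `[-1, 1], continuous (fun x => `|v x|)}.
  by apply: continuous_subspaceT => x; apply: cvg_norm; exact: cv.
have [|x0 _ Hx0] := EVT_max _ cnv; first lra.
exists (`|v x0| + C) => x.
have [x1|x1] := leP `|x| 1.
  apply: (@le_trans _ _ `|v x0|); last by rewrite lerDl.
  by apply: Hx0; rewrite in_itv/= -ler_norml.
apply: le_trans (vC x (ltW x1)) _; rewrite ler_pdivrMr; last lra.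
apply: (@le_trans _ _ (C * `|x|)); first by rewrite ler_peMr// ltW.
by rewrite ler_wpM2r// lerDr.
Qed.

Lemma vanishing_uniformly_continuous v : continuous v -> vanishing v ->
  uniformly_continuous v.
Proof.
move=> cv [C vC] e e0.
have C0 : 0 <= C.
  by have := vC 1; rewrite normr1 divr1 lexx => /(_ isT); exact: le_trans.
(* Beyond A the values are at most e / 2. If |x| > A + 1 and |x - y| <= 1, both points lie beyond A;
   otherwise compactness applies. *)
pose A := 1 + 2 * C / e.
have A1 : 1 <= A by rewrite lerDl divr_ge0// ?mulr_ge0// ltW.
have [r r0 Hr] := compact_uniformly_continuous cv (@segment_compact _ (- (A + 1)) (A + 1)) e0.
have small x : A <= `|x| -> `|v x| <= e / 2.
  move=> Ax; have x0 : 0 < `|x| by lra.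
  apply: le_trans (vC _ _) _; first by lra.
  rewrite ler_pdivrMr//.
  have : e / 2 * A <= e / 2 * `|x| by rewrite ler_wpM2l// divr_ge0// ltW.
  apply: le_trans; rewrite /A mulrDr.
  have -> : e / 2 * (2 * C / e) = C by field; rewrite gt_eqF.
  by rewrite lerDr mulr1 divr_ge0// ltW.
exists (Num.min r 1); first by rewrite lt_min r0 ltr01.
move=> x y; rewrite le_min => /andP[xyr xy1].
have [xA|Ax] := leP `|x| (A + 1).
  by apply: Hr => //=; rewrite in_itv/= -ler_norml.
apply: le_trans (ler_normB _ _) _.
have : `|x| <= `|x - y| + `|y| by rewrite -{1}(subrK y x) ler_normD.
by have := small x; have := small y; lra.
Qed.

End VanishingFunctions.

(** * The damped test function *)

Section SteinTest.
Context (R : realType).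
Variables (h g : R -> R) (H N b : R).
Hypothesis hg : forall x : R, is_derive x (1 : R) h (x * h x + g x).
Hypothesis cg : continuous g.
Hypothesis hH : forall x, `|h x| <= H.
Hypothesis gN : forall x, `|g x| <= N.
Hypothesis b0 : 0 < b.

Let ch : continuous h. Proof. exact: is_derive_continuous hg. Qed.
Let H0 : 0 <= H. Proof. exact: le_trans (hH 0). Qed.
Let N0 : 0 <= N. Proof. exact: le_trans (gN 0). Qed.

Let q (x : R) := 1 + b ^+ 2 * x ^+ 2.
Let chi (x : R) := (q x)^-1.
Let dchi (x : R) := - (2 * b ^+ 2 * x * chi x ^+ 2).

Let q0 x : 0 < q x.
Proof. by rewrite /q ltr_pwDl// mulr_ge0 ?sqr_ge0. Qed.

Let chi0 x : 0 < chi x. Proof. by rewrite invr_gt0. Qed.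

Let chi1 x : chi x <= 1.
Proof. by rewrite invf_le1// lerDl mulr_ge0 ?sqr_ge0. Qed.

Let is_derive_q x : is_derive x (1 : R) q (2 * b ^+ 2 * x).
Proof.
have scaleE (u v : R) : u *: v = u * v by [].
have -> : q = cst 1 + (b ^+ 2 \*: (id ^+ 2 : R -> R)).
  by apply/funext => y; rewrite /q fctE /= exprfctE scaleE.
apply: is_derive_eq; rewrite !scaleE /=; ring.
Qed.

Let is_derive_chi x : is_derive x (1 : R) chi (dchi x).
Proof.
have scaleE (u v : R) : u *: v = u * v by [].
apply: is_derive_eq (is_deriveV _ (is_derive_q x)) _; first by rewrite gt_eqF.
by rewrite scaleE /dchi /chi; field; rewrite gt_eqF.
Qed.

Let cchi : continuous chi. Proof. exact: is_derive_continuous is_derive_chi. Qed.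

Let cdchi : continuous dchi.
Proof.
move=> x; apply: cvgN; apply: cvgM; last by apply: cvgM; exact: cchi.
by apply: cvgM; [exact: cvg_cst|exact: cvg_id].
Qed.

Let qchi x : q x * chi x = 1. Proof. by rewrite /chi divff// gt_eqF. Qed.

Let sqr_chi_le x : b ^+ 2 * x ^+ 2 * chi x <= 1.
Proof. by rewrite -[leRHS](qchi x) ler_wpM2r// ?(ltW (chi0 x))// lerDr. Qed.

(** From 2 b |x| <= 1 + b ^+ 2 x ^+ 2. This is the source of the bound |chi'| <= b. *)
Let lin_chi_le x : 2 * b * `|x| * chi x <= 1.
Proof.
rewrite -[leRHS](qchi x) ler_wpM2r// ?(ltW (chi0 x))// /q -[x ^+ 2]real_normK ?num_real//.
by have := sqr_ge0 (1 - b * `|x|); lra.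
Qed.

Let normr_dchi x : `|dchi x| = 2 * b ^+ 2 * `|x| * chi x ^+ 2.
Proof.
have c0 : 0 <= 2 * b ^+ 2 * chi x ^+ 2.
  by apply: mulr_ge0; [apply: mulr_ge0 => //|]; exact: sqr_ge0.
rewrite normrN (_ : 2 * b ^+ 2 * x * chi x ^+ 2 = 2 * b ^+ 2 * chi x ^+ 2 * x).
  by rewrite normrM (ger0_norm c0); ring.
by ring.
Qed.

Let dchi_le x : `|dchi x| <= b.
Proof.
rewrite normr_dchi.
have -> : 2 * b ^+ 2 * `|x| * chi x ^+ 2 = b * ((2 * b * `|x| * chi x) * chi x) by ring.
rewrite ler_piMr ?(ltW b0)// mulr_ile1// ?(ltW (chi0 x))//.
by rewrite !mulr_ge0// ltW.
Qed.

Let dchi_lex x : x != 0 -> `|dchi x| <= 2 / `|x|.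
Proof.
move=> x0; rewrite ler_pdivlMr ?normr_gt0// normr_dchi.
have -> : 2 * b ^+ 2 * `|x| * chi x ^+ 2 * `|x| =
    2 * ((b ^+ 2 * `|x| ^+ 2 * chi x) * chi x) by ring.
rewrite real_normK ?num_real// ler_piMr// mulr_ile1// ?(ltW (chi0 x))//.
by apply: mulr_ge0; [apply: mulr_ge0; exact: sqr_ge0|exact: ltW].
Qed.

Let xchi_lex x : x != 0 -> `|x| * chi x <= b ^- 2 / `|x|.
Proof.
move=> x0; rewrite ler_pdivlMr ?normr_gt0// -[leRHS]mul1r.
rewrite ler_pdivlMr ?exprn_gt0//.
have -> : `|x| * chi x * `|x| * b ^+ 2 = b ^+ 2 * `|x| ^+ 2 * chi x by ring.
by rewrite real_normK ?num_real.
Qed.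

Let chi_lex x : 1 <= `|x| -> chi x <= b ^- 2 / `|x|.
Proof.
move=> x1; apply: le_trans (xchi_lex _); last by rewrite -normr_gt0; lra.
by rewrite ler_peMl// ltW.
Qed.

(* The weight chi makes both the derivative of damped and damped' - x damped vanish at
   infinity; the price 1 - chi x <= b ^+ 2 x ^+ 2 and |chi'| <= b is paid by a second
   moment bound. *)
Definition damped x := h x * chi x.
Definition damped_derive x := (x * h x + g x) * chi x + h x * dchi x.

Lemma is_derive_damped x : is_derive x (1 : R) damped (damped_derive x).
Proof.
have scaleE (u v : R) : u *: v = u * v by [].
apply: is_derive_eq (is_deriveM (hg x) (is_derive_chi x)) _.
by rewrite !scaleE /damped_derive; ring.
Qed.

Lemma continuous_damped_derive : continuous damped_derive.
Proof.
move=> x; apply: cvgD; apply: cvgM; [|exact: cchi|exact: ch|exact: cdchi].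
by apply: cvgD; [apply: cvgM; [exact: cvg_id|exact: ch]|exact: cg].
Qed.

Lemma normr_damped x : `|damped x| <= H.
Proof.
rewrite normrM (ger0_norm (ltW (chi0 x))) -[leRHS]mulr1 ler_pM//.
exact: ltW.
Qed.

(** The terms x h chi cancel, so this combination contains only bounded functions times chi or
    chi'. *)
Lemma steinE x : damped_derive x - x * damped x = g x * chi x + h x * dchi x.
Proof. by rewrite /damped_derive /damped; ring. Qed.

(** The quadratic decay of chi absorbs the possible linear growth of x h x and leaves 1 / |x|. The
    constant blows up as b tends to 0, which is harmless since b is fixed before n. *)
Lemma vanishing_damped_derive : vanishing damped_derive.
Proof.
exists (H * b ^- 2 + N * b ^- 2 + H * 2) => x x1.
have x0 : x != 0 by rewrite -normr_gt0; lra.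
rewrite mulrDl mulrDl; apply: le_trans (ler_normD _ _) (lerD _ _).
  rewrite mulrDl; apply: le_trans (ler_normD _ _) (lerD _ _).
    rewrite !normrM (ger0_norm (ltW (chi0 x))) mulrAC [leLHS]mulrC -mulrA.
    by rewrite ler_pM// ?mulr_ge0// ?(ltW (chi0 x))// xchi_lex.
  rewrite normrM (ger0_norm (ltW (chi0 x))) -mulrA ler_pM// ?chi_lex//.
  exact: ltW.
by rewrite normrM -mulrA ler_pM// dchi_lex.
Qed.

Lemma vanishing_stein : vanishing (fun x => damped_derive x - x * damped x).
Proof.
exists (N * b ^- 2 + H * 2) => x x1; rewrite steinE.
have x0 : x != 0 by rewrite -normr_gt0; lra.
rewrite mulrDl; apply: le_trans (ler_normD _ _) (lerD _ _).
  rewrite normrM (ger0_norm (ltW (chi0 x))) -mulrA ler_pM// ?chi_lex//.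
  exact: ltW.
by rewrite normrM -mulrA ler_pM// dchi_lex.
Qed.

Lemma stein_approx x :
  `|damped_derive x - x * damped x - g x| <= N * (b ^+ 2 * x ^+ 2) + H * b.
Proof.
rewrite steinE addrAC -[X in _ * _ - X]mulr1 -mulrBr.
apply: le_trans (ler_normD _ _) (lerD _ _); rewrite normrM ler_pM//.
rewrite distrC ger0_norm ?subr_ge0//.
have -> : 1 - chi x = b ^+ 2 * x ^+ 2 * chi x.
  by have := qchi x; rewrite /q mulrDl mul1r; lra.
by rewrite ler_piMr// mulr_ge0 ?sqr_ge0.
Qed.

End SteinTest.

(** * Convergence *)

Section Approximation.
Context (R : realType) (d : measure_display) (T : measurableType d).
Variables (P : probability T R) (L : R -> {RV P >-> R}).
Hypothesis hL : levy_process L.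
Hypothesis hL2 : forall s : R, (L s : T -> R) \in Lfun P 2%:E.
Hypothesis hL_mean : forall s : R, ('E_P[L s] = 0)%E.
Hypothesis hL_var : ('V_P[L 1%R] = 1)%E.

Lemma stoch_integral_clip_approx (f : R -> R) (X : {RV P >-> R})
    (eta eps F a : R) :
  f \in Lfun (@lebesgue_measure R) 2%:E ->
  is_stoch_integral L f X -> 0 <= eta -> 0 < eps -> 0 < a ->
  (\int[lebesgue_measure]_s ((f s) ^+ 2)%:E = F%:E)%E ->
  (\int[lebesgue_measure]_(s in [set s | (eta < `|f s|)%R])
          ((f s) ^+ 2)%:E <= eps%:E)%E ->
  sqintble P X /\ exists m t c, let W := step_integral L m t c in
    [/\ nondecreasing_seq t, forall i, `|c i| <= eta,
      Ex P (fun w => (X w - W w) ^+ 2) <= 10 * eps &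
      `|Ex P (fun w => W w ^+ 2) - F| <= a * F + (1 + a^-1) * (4 * eps)].
Proof.
move=> fL2 [m [t [c [ndt ft Xt]]]] eta0 eps0 a0 fF ftail.
have mf : measurable_fun setT f.
  by move: fL2; rewrite inE => /andP[]; rewrite inE.
have near_le (u : nat -> \bar R) : u @ \oo --> 0%E ->
    \forall k \near \oo, (u k <= eps%:E)%E.
  move=> /fine_cvgP[ufin /cvgrPdist_le/(_ _ eps0) ueps].
  near=> k; rewrite -(fineK (x := u k)); last by near: k.
  rewrite lee_fin (le_trans (ler_norm _))// -normrN -[X in `|X|]add0r.
  by near: k.
have [k [fk Xk]] := filter_ex (filterI (near_le _ ft) (near_le _ Xt)).
set S := step_integral L (m k) (t k) (c k) in Xk.
have sS : sqintble P S by exact: step_integral_sqintble.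
(* Square integrability of [X] is not part of [is_stoch_integral]; it comes from the finite L^2
   distance to the square integrable [S]. *)
have sXS : sqintble P (fun w => X w - S w).
  have mXS : measurable_fun setT (fun w => X w - S w).
    by apply: measurable_funB => //; case: sS.
  split=> //; apply/integrableP; split.
    by apply/measurable_EFinP; exact: measurable_funX.
  apply: le_lt_trans (ltry eps); apply: le_trans Xk.
  rewrite le_eqVlt; apply/orP; left; apply/eqP; apply: eq_integral => w _.
  by rewrite /= ger0_norm ?sqr_ge0.
have sX : sqintble P X.
  by apply: eq_sqintble (sqintbleD sXS sS) => w; rewrite subrK.
have EXS : Ex P (fun w => (X w - S w) ^+ 2) <= eps.
  by rewrite -lee_fin -EFin_Ex//; case: sXS.
split=> //; exists (m k), (t k), (clip eta \o c k) => W.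
have sW : sqintble P W by exact: step_integral_sqintble.
have sSW : sqintble P (fun w => S w - W w) by exact: sqintbleB.
have sXW : sqintble P (fun w => X w - W w) by exact: sqintbleB.
split=> //.
- by move=> i; exact: normr_clip.
- have ESW : Ex P (fun w => (S w - W w) ^+ 2) <= 2 * eps + 2 * eps.
    apply: le_trans (step_fun_sub_clip mf (ndt k) eta0 fk ftail).
    have := step_integral_isometry hL hL2 hL_mean hL_var (m k)
      (fun i => c k i - clip eta (c k i)) (ndt k).
    rewrite le_eqVlt => <-; apply/orP; left; apply/eqP; apply: eq_Ex => w.
    congr (_ ^+ 2); rewrite /S /W /step_integral -sumrB; apply: eq_bigr => i _.
    by rewrite -mulrBl.
  (* The constant 10 is 2 * 1 from X - S plus 2 * 4 from S - W. *)
  apply: (@le_trans _ _ (Ex P (fun w => 2 * (X w - S w) ^+ 2 + 2 * (S w - W w) ^+ 2))).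
    apply: Ex_le.
    + by case: sXW.
    + by apply: intbleD; apply: intbleZ; [case: sXS|case: sSW].
    + by move=> w; rewrite -(subrKA (S w)) sqrrD_le.
  rewrite ExD; [|by apply: intbleZ; case: sXS|by apply: intbleZ; case: sSW].
  by rewrite !ExZ; [lra|case: sSW|case: sXS].
- have := step_fun_clip_norm mf (ndt k) eta0 fk ftail fF a0.
  rewrite step_integral_isometry//=.
  by have -> : 2 * eps + 2 * eps = 4 * eps by ring.
Unshelve. all: by end_near. Qed.

Lemma stoch_integral_seq_approx (f : nat -> R -> R) (X : nat -> {RV P >-> R})
    (eta delta : R) :
  (forall n, f n \in Lfun (@lebesgue_measure R) 2%:E) ->
  (\int[lebesgue_measure]_s ((f n s) ^+ 2)%:E)%E @[n --> \oo] --> 1%E ->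
  (\int[lebesgue_measure]_(s in [set s | (eta < `|f n s|)%R])
          ((f n s) ^+ 2)%:E)%E @[n --> \oo] --> 0%E ->
  (forall n, is_stoch_integral L (f n) (X n)) ->
  0 <= eta -> 0 < delta <= 1 ->
  \forall n \near \oo,
  sqintble P (X n) /\ exists m t c, let W := step_integral L m t c in
    [/\ nondecreasing_seq t, forall i, `|c i| <= eta,
      Ex P (fun w => (X n w - W w) ^+ 2) <= delta &
      `|Ex P (fun w => W w ^+ 2) - 1| <= delta].
Proof.
move=> fL2 fF ftail fX eta0 /andP[d0 d1].
(* For large n, F <= 2, so a F <= delta / 4; [eps] makes the other term of the clipping estimate
   equal to delta / 4. Moreover 16 eps <= delta, which covers both 10 eps and the distance from F to
   1. *)
pose a := delta / 8; have a0 : 0 < a by rewrite divr_gt0.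
have a1 : 0 < 1 + a^-1 by rewrite addr_gt0// invr_gt0.
pose eps := delta / (16 * (1 + a^-1)).
have eps0 : 0 < eps by rewrite divr_gt0// mulr_gt0.
have eps1 : (1 + a^-1) * (4 * eps) = delta / 4.
  by have := gt_eqF a1; rewrite /eps; move: (1 + a^-1) => u u0; field; rewrite u0.
have eps2 : 16 * eps <= delta.
  have -> : 16 * eps = delta / (1 + a^-1).
    by have := gt_eqF a1; rewrite /eps; move: (1 + a^-1) => u u0; field; rewrite u0.
  by rewrite ler_pdivrMr// ler_peMr ?(ltW d0)// lerDl invr_ge0 ltW.
have /fine_cvgP[tailfin /cvgrPdist_le/(_ _ eps0) tail] := ftail.
have /fine_cvgP[Ffin /cvgrPdist_le/(_ _ eps0) Fn] := fF.
near=> n.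
pose F := fine (\int[lebesgue_measure]_s ((f n s) ^+ 2)%:E)%E.
have FE : (\int[lebesgue_measure]_s ((f n s) ^+ 2)%:E)%E = F%:E.
  by rewrite fineK//; near: n.
have F1 : `|1 - F| <= eps by rewrite /F; near: n.
have tn : (\int[lebesgue_measure]_(s in [set s | (eta < `|f n s|)%R])
          ((f n s) ^+ 2)%:E <= eps%:E)%E.
  rewrite -[leLHS]fineK; last by near: n.
  rewrite lee_fin (le_trans (ler_norm _))// -normrN -[X in `|X|]add0r.
  by near: n.
have [sX [m [t [c [ndt ceta XW WF]]]]] :=
  stoch_integral_clip_approx (fL2 n) (fX n) eta0 eps0 a0 FE tn.
split=> //; exists m, t, c; split=> //; first lra.
move: F1 WF; rewrite eps1 !ler_norml => /andP[F1 F2] /andP[W1 W2].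
have : a * F <= delta / 4.
  have -> : delta / 4 = a * 2 by rewrite /a; field.
  by rewrite ler_wpM2l ?(ltW a0)//; lra.
by move=> aF; apply/andP; split; lra.
Unshelve. all: by end_near. Qed.

End Approximation.

(** Where |X - W| <= r the modulus of [u] applies; elsewhere 2 U is paid on an event whose
    probability Chebyshev's inequality bounds by E[(X - W) ^+ 2] / r ^+ 2. *)
Lemma Ex_uniformly_continuous_le (R : realType) (d : measure_display)
    (T : measurableType d) (P : probability T R) (X W : T -> R)
    (u : R -> R) (U m r : R) :
  sqintble P X -> sqintble P W -> continuous u -> (forall x, `|u x| <= U) ->
  0 < r -> 0 <= m -> (forall x y, `|x - y| <= r -> `|u x - u y| <= m) ->
  `|Ex P (fun w => u (X w)) - Ex P (fun w => u (W w))| <=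
  m + 2 * U / r ^+ 2 * Ex P (fun w => (X w - W w) ^+ 2).
Proof.
move=> sX sW cu uU r0 m0 um.
have mu : measurable_fun setT u by exact: continuous_measurable_fun.
have iu Y : sqintble P Y -> intble P (fun w => u (Y w)).
  move=> [mY _]; apply: (@intble_bounded _ _ _ _ _ U) => // .
  exact: measurableT_comp.
have U0 : 0 <= U by exact: le_trans (uU 0).
have [mXW iXW] := sqintbleB sX sW.
rewrite -ExB; [|exact: iu..].
rewrite -[X in X + _](Ex_cst P) -ExZ// -ExD; [|exact: intble_cst|exact: intbleZ].
apply: normr_Ex_le.
- exact: intble_measurable (intbleB (iu _ sX) (iu _ sW)).
- by apply: intbleD; [exact: intble_cst|exact: intbleZ].
move=> w; have [le_r|lt_r] := leP `|X w - W w| r.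
  apply: le_trans (um _ _ le_r) _; rewrite lerDl.
  by rewrite mulr_ge0 ?sqr_ge0// divr_ge0 ?sqr_ge0// mulr_ge0.
apply: le_trans (ler_normB _ _) _; rewrite -[leLHS]add0r lerD//.
apply: (@le_trans _ _ (2 * U)); first by have := uU (X w); have := uU (W w); lra.
rewrite -mulrA ler_peMr ?mulr_ge0// mulrC ler_pdivlMr ?exprn_gt0// mul1r.
rewrite -[leRHS]real_normK ?num_real// lerXn2r ?nnegrE ?(ltW r0)//.
exact: ltW.
Qed.

(** * Stein's identity in the limit *)

Section SteinLimit.
Context (R : realType) (d : measure_display) (T : measurableType d).
Variables (P : probability T R) (L : R -> {RV P >-> R}).
Hypothesis hL : levy_process L.
Hypothesis hL2 : forall s : R, (L s : T -> R) \in Lfun P 2%:E.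
Hypothesis hL_mean : forall s : R, ('E_P[L s] = 0)%E.
Hypothesis hL_var : ('V_P[L 1%R] = 1)%E.
Variables (f : nat -> R -> R) (X : nat -> {RV P >-> R}).
Hypothesis hf : forall n, f n \in Lfun (@lebesgue_measure R) 2%:E.
Hypothesis hf_norm : (\int[lebesgue_measure]_s ((f n s) ^+ 2)%:E)%E
                 @[n --> \oo] --> 1%E.
Hypothesis hf_tail : forall eta : R, 0 < eta ->
       (\int[lebesgue_measure]_(s in [set s | (eta < `|f n s|)%R])
          ((f n s) ^+ 2)%:E)%E @[n --> \oo] --> 0%E.
Hypothesis hX : forall n, is_stoch_integral L (f n) (X n).

(** With eta = delta = 1 the approximation W satisfies E[W ^+ 2] <= 2, so E[X ^+ 2] <= 2 * 1 + 2 *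
    2. *)
Lemma second_moment_near_le : \forall n \near \oo,
  sqintble P (X n) /\ Ex P (fun w => X n w ^+ 2) <= 6.
Proof.
have h1 : 0 < (1 : R) <= 1 by rewrite ltr01 lexx.
apply: filterS (stoch_integral_seq_approx hL hL2 hL_mean hL_var hf hf_norm
  (hf_tail ltr01) hX ler01 h1) => n [sX [m [t [c [ndt _ XW W1]]]]].
split=> //; set W := step_integral L m t c in XW W1.
have sW : sqintble P W by exact: step_integral_sqintble.
have [_ iXW] := sqintbleB sX sW.
apply: (@le_trans _ _ (Ex P (fun w => 2 * (X n w - W w) ^+ 2 + 2 * W w ^+ 2))).
  apply: Ex_le; first by case: sX.
    by apply: intbleD; apply: intbleZ => //; case: sW.
  by move=> w; rewrite -{1}(subrK (W w) (X n w)) sqrrD_le.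
rewrite ExD; [|exact: intbleZ|by apply: intbleZ; case: sW].
rewrite !ExZ//; last by case: sW.
by move: W1; rewrite ler_norml => /andP[_]; lra.
Qed.

Variables (k dk : R -> R) (A : R).
Hypothesis hdk : forall x : R, is_derive x (1 : R) k (dk x).
Hypothesis cdk : continuous dk.
Hypothesis kA : forall x, `|k x| <= A.
Hypothesis vdk : vanishing dk.
Hypothesis vu : vanishing (fun x => dk x - x * k x).

Let u x := dk x - x * k x.

Let ck : continuous k. Proof. exact: is_derive_continuous hdk. Qed.

Let cu : continuous u.
Proof. by move=> x; apply: cvgB; [exact: cdk|apply: cvgM; [exact: cvg_id|exact: ck]]. Qed.

(** E[u(X n)] is replaced by E[u(W)] = E[dk(W)] - E[W k(W)], which Stein's identity and E[W ^+ 2]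
    close to 1 make small. The choices are ordered: [e] and [r] from the moduli of dk and u, K from
    the tail of one increment, eta from e and K, then delta, and n last. *)
Lemma stein_limit (rho : R) : 0 < rho ->
  \forall n \near \oo, `|Ex P (fun w => u (X n w))| <= rho.
Proof.
move=> rho0.
have [B dkB] := vanishing_bounded cdk vdk.
have [U uU] := vanishing_bounded cu vu.
have B0 : 0 <= B by exact: le_trans (dkB 0).
have U0 : 0 <= U by exact: le_trans (uU 0).
(* B and U may be 0; the shifted constants can be divided by. *)
have B1 : 0 < B + 1 by lra.
have U1 : 0 < U + 1 by lra.
have rho32 : 0 < rho / 32 by rewrite divr_gt0.
have rho4 : 0 < rho / 4 by rewrite divr_gt0.
have [e e0 dke] := vanishing_uniformly_continuous cdk vdk rho32.
have [r r0 ur] := vanishing_uniformly_continuous cu vu rho4.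
have q0 : 0 < rho / (256 * (B + 1)) by rewrite divr_gt0// mulr_gt0.
have [M M1 qM] := sqintble_tail (increment_sqintble hL2 0 1) q0.
(* The tail bound for short increments refers to the level K / 4 of the unit increment. *)
pose K : R := 4 * M; have K1 : 1 <= K by rewrite /K; lra.
have K0 : 0 < K by exact: lt_le_trans ltr01 K1.
have KM : K / 4 = M by rewrite /K; field.
(* With eta = e s / K, s <= 1 yields K eta <= e, and K >= 1 yields eta ^+ 2 / e ^+ 2 <= s. *)
pose s := Num.min 1 (rho / (32 * (B + 1))).
have s0 : 0 < s by rewrite lt_min ltr01 divr_gt0// mulr_gt0.
have s1 : s <= 1 by rewrite ge_min lexx.
have sB : B * s <= rho / 32.
  have : s <= rho / (32 * (B + 1)) by rewrite ge_min lexx orbT.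
  move=> /(ler_wpM2l (ltW B1)).
  have -> : (B + 1) * (rho / (32 * (B + 1))) = rho / 32 by field; rewrite gt_eqF.
  by apply: le_trans; rewrite ler_wpM2r ?(ltW s0)// lerDl.
pose eta := e * s / K.
have eta0 : 0 < eta by rewrite divr_gt0// mulr_gt0.
have Keta : K * eta <= e.
  by rewrite /eta mulrC divfK ?gt_eqF// ler_piMr// ltW.
have etae : eta ^+ 2 / e ^+ 2 <= s.
  have -> : eta ^+ 2 / e ^+ 2 = (s / K) ^+ 2 by rewrite /eta; field; rewrite !gt_eqF.
  have sK0 : 0 <= s / K by rewrite divr_ge0// ltW.
  have sKs : s / K <= s by rewrite ler_pdivrMr// ler_peMr// ltW.
  by rewrite expr2 (le_trans _ sKs)// ler_piMr// (le_trans sKs).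
pose delta := Num.min 1 (Num.min (rho / (8 * (B + 1))) (rho * r ^+ 2 / (16 * (U + 1)))).
have r20 : 0 < r ^+ 2 by rewrite exprn_gt0.
have d0 : 0 < delta.
  by rewrite !lt_min ltr01 !divr_gt0// mulr_gt0.
have d1 : delta <= 1 by rewrite ge_min lexx.
have dB : delta * B <= rho / 8.
  have : delta <= rho / (8 * (B + 1)) by rewrite !ge_min lexx !orbT.
  move=> /(ler_wpM2r (ltW B1)).
  have -> : rho / (8 * (B + 1)) * (B + 1) = rho / 8 by field; rewrite gt_eqF.
  by apply: le_trans; rewrite ler_wpM2l ?(ltW d0)// lerDl.
have dU : 2 * U / r ^+ 2 * delta <= rho / 8.
  have : delta <= rho * r ^+ 2 / (16 * (U + 1)) by rewrite !ge_min lexx !orbT.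
  move=> /(ler_wpM2l (ltW (divr_gt0 (mulr_gt0 (ltr0n _ 2) U1) r20))).
  have -> : 2 * (U + 1) / r ^+ 2 * (rho * r ^+ 2 / (16 * (U + 1))) = rho / 8.
    by field; rewrite !gt_eqF.
  apply: le_trans; rewrite ler_wpM2r ?(ltW d0)// ler_wpM2r ?invr_ge0 ?(ltW r20)//.
  by rewrite ler_wpM2l// lerDl.
have d01 : 0 < delta <= 1 by rewrite d0 d1.
apply: filterS (stoch_integral_seq_approx hL hL2 hL_mean hL_var hf hf_norm
  (hf_tail eta0) hX (ltW eta0) d01) => n [sX [m [t [c [ndt ceta XW W1]]]]].
set W := step_integral L m t c in XW W1.
have sW : sqintble P W by exact: step_integral_sqintble.
have mW : measurable_fun setT W by case: sW.
have := stein_step_integral hL hL2 hL_mean hL_var hdk cdk e0 kA dkB dke K1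
  (ltW eta0) Keta m ndt ceta.
rewrite -/W KM.
set V := Ex P (fun w => W w ^+ 2) in W1 *; set q := Ex P _ in qM *.
set EWk := Ex P (fun w => W w * k (W w)); set Edk := Ex P (fun w => dk (W w)).
move=> stein.
have EuW : Ex P (fun w => u (W w)) = Edk - EWk.
  rewrite /u ExB//.
    apply: (@intble_bounded _ _ _ _ _ B) => //; apply: measurableT_comp => //.
    exact: continuous_measurable_fun.
  apply: sqintbleM => //; apply: (@sqintble_bounded _ _ _ _ _ A) => //.
  apply: measurableT_comp => //; exact: continuous_measurable_fun.
have EdkB : `|Edk| <= B.
  rewrite -[leRHS](Ex_cst P); apply: normr_Ex_le => //; last exact: intble_cst.
  by apply: measurableT_comp => //; exact: continuous_measurable_fun.
have := Ex_uniformly_continuous_le sX sW cu uU r0 (ltW rho4) ur.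
rewrite EuW => trans.
have transd : 2 * U / r ^+ 2 * Ex P (fun w => (X n w - W w) ^+ 2) <= rho / 8.
  apply: le_trans dU; rewrite ler_wpM2l//.
  by apply: divr_ge0; [exact: mulr_ge0|exact: sqr_ge0].
have V0 : 0 <= V by apply: Ex_ge0 => w; exact: sqr_ge0.
have V2 : V <= 2 by move: W1; rewrite ler_norml => /andP[_]; lra.
have qB : B * q <= rho / 256.
  move: qM => /(ler_wpM2l (ltW B1)).
  have -> : (B + 1) * (rho / (256 * (B + 1))) = rho / 256 by field; rewrite gt_eqF.
  apply: le_trans; rewrite ler_wpM2r// ?lerDl//.
  by apply: Ex_ge0 => w; apply: mulr_ge0; [exact: sqr_ge0|exact: outside_ge0].
(* The error budget is 3 rho / 8 here, rho / 8 for replacing E[W ^+ 2] by 1, and rho / 4 + rho / 8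
   for passing from X n to W: 7 rho / 8 in all. *)
have stein' : `|EWk - V * Edk| <= 2 * (2 * (rho / 32) + 2 * (rho / 32) + 16 * (rho / 256)).
  apply: le_trans stein _; apply: ler_pM => //.
    have q00 : 0 <= q.
      by apply: Ex_ge0 => w; apply: mulr_ge0; [exact: sqr_ge0|exact: outside_ge0].
    have : 0 <= 2 * B * (eta ^+ 2 / e ^+ 2).
      by apply: mulr_ge0; [apply: mulr_ge0|apply: divr_ge0; exact: sqr_ge0].
    have : 0 <= 16 * B * q by apply: mulr_ge0 => //; apply: mulr_ge0.
    lra.
  have : B * (eta ^+ 2 / e ^+ 2) <= rho / 32.
    by apply: le_trans sB; rewrite ler_wpM2l.
  lra.
have VB : `|(V - 1) * Edk| <= rho / 8.
  by rewrite normrM; apply: le_trans dB; rewrite ler_pM.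
move: trans stein' VB; rewrite !ler_norml => /andP[? ?] /andP[? ?] /andP[? ?].
by apply/andP; split; lra.
Qed.

End SteinLimit.

Theorem proposition1 (R : realType) (d : measure_display)
    (T : measurableType d) (P : probability T R)
    (L : R -> {RV P >-> R})
    (hL : levy_process L)
    (hL2 : forall s : R, (L s : T -> R) \in Lfun P 2%:E)
    (hL_mean : forall s : R, ('E_P[L s] = 0)%E)
    (hL_var : ('V_P[L 1%R] = 1)%E)
    (f : nat -> R -> R)
    (hf : forall n, f n \in Lfun (@lebesgue_measure R) 2%:E)
    (hf_norm : (\int[lebesgue_measure]_s ((f n s) ^+ 2)%:E)%E
                 @[n --> \oo] --> 1%E)
    (hf_tail : forall eta : R, 0 < eta ->
       (\int[lebesgue_measure]_(s in [set s | (eta < `|f n s|)%R])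
          ((f n s) ^+ 2)%:E)%E @[n --> \oo] --> 0%E)
    (X : nat -> {RV P >-> R})
    (hX : forall n, is_stoch_integral L (f n) (X n)) :
  cvg_in_distribution X (normal_prob 0 1).
Proof.
move=> g cg [M gM].
pose c := fine (\int[normal_prob 0 1]_x (g x)%:E)%E.
have mg : measurable_fun setT g by exact: continuous_measurable_fun.
have gc : (\int[normal_prob 0 1]_x (g x)%:E = c%:E)%E.
  rewrite fineK//; apply: integrable_fin_num => //.
  exact: (@intble_bounded _ _ _ (normal_prob 0 1) g M).
have igX n : intble P (fun w => g (X n w)).
  by apply: (@intble_bounded _ _ _ _ _ M) => //; exact: measurableT_comp.
have EgX n : ('E_P[g \o X n] = (Ex P (fun w => g (X n w)))%:E)%E.
  by rewrite unlock -EFin_Ex.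
rewrite gc; under eq_fun do rewrite EgX.
apply: cvg_EFin; first exact: nearW.
apply/cvgrPdist_le => /= e e0.
have [H hH] := stein_solution_bounded cg gM gc.
have H0 : 0 <= H by exact: le_trans (hH 0).
have cgc : continuous (fun x => g x - c).
  by move=> x; apply: cvgB; [exact: cg|exact: cvg_cst].
pose N := M + `|c|.
have gN x : `|g x - c| <= N by rewrite (le_trans (ler_normB _ _))// lerD2r.
have N0 : 0 <= N by exact: le_trans (gN 0).
(* Chosen for [bNH], where 6 is the eventual bound on E[X n ^+ 2]; b <= 1 allows b ^+ 2 to be
   replaced by b. *)
pose b := Num.min 1 (e / (2 * (6 * N + H + 1))).
have NH : 0 < 6 * N + H + 1 by rewrite ltr_wpDl// addr_ge0// mulr_ge0.
have b0 : 0 < b by rewrite lt_min ltr01 divr_gt0// mulr_gt0.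
have b1 : b <= 1 by rewrite ge_min lexx.
have bNH : N * b ^+ 2 * 6 + H * b <= e / 2.
  have b2 : b ^+ 2 <= b by rewrite expr2 ler_piMr// ltW.
  have : b <= e / (2 * (6 * N + H + 1)) by rewrite ge_min lexx orbT.
  move=> /(ler_wpM2l (ltW NH)).
  have -> : (6 * N + H + 1) * (e / (2 * (6 * N + H + 1))) = e / 2.
    by field; rewrite gt_eqF.
  apply: le_trans; have := ler_wpM2l N0 b2; lra.
pose hg x := stein_solutionP c cg gM x.
have lim := stein_limit hL hL2 hL_mean hL_var hf hf_norm hf_tail hX
  (is_derive_damped b hg) (@continuous_damped_derive _ _ _ b hg cgc)
  (normr_damped b hH) (vanishing_damped_derive hH gN b0)
  (vanishing_stein hH gN b0).
have e2 : 0 < e / 2 by rewrite divr_gt0.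
apply: filterS2 (lim _ e2) (second_moment_near_le hL hL2 hL_mean hL_var hf
  hf_norm hf_tail hX) => n Eu [[mX iX2] X6].
pose h := stein_solution g c.
pose u x := damped_derive h (fun x => g x - c) b x - x * damped h b x.
have cu : continuous u.
  move=> x; apply: cvgB; first exact: (@continuous_damped_derive _ _ _ b hg cgc).
  apply: cvgM; first exact: cvg_id.
  exact: (is_derive_continuous (is_derive_damped b hg)).
have [U uU] := vanishing_bounded cu (vanishing_stein hH gN b0).
have iu : intble P (fun w => u (X n w)).
  apply: (@intble_bounded _ _ _ _ _ U) => //; apply: measurableT_comp => //.
  exact: continuous_measurable_fun.
have iug : intble P (fun w => u (X n w) - (g (X n w) - c)).
  by apply: intbleB => //; apply: intbleB => //; exact: intble_cst.
(* The first expectation is the cost of damping, bounded through the second moment; the second one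
   tends to 0 by [stein_limit]. *)
have -> : c - Ex P (fun w => g (X n w)) =
    Ex P (fun w => u (X n w) - (g (X n w) - c)) - Ex P (fun w => u (X n w)).
  have igc := intbleB (igX n) (intble_cst P c).
  have Eg : Ex P (fun w => g (X n w) - c) = Ex P (fun w => g (X n w)) - c.
    by rewrite ExB ?Ex_cst//; exact: intble_cst.
  by rewrite ExB// Eg; ring.
apply: le_trans (ler_normB _ _) _.
have -> : e = e / 2 + e / 2 by field.
apply: lerD => //; apply: le_trans _ bNH.
have iX2' := intbleZ (N * b ^+ 2) iX2.
apply: (@le_trans _ _ (Ex P (fun w => N * b ^+ 2 * X n w ^+ 2 + H * b))).
  apply: normr_Ex_le; first exact: intble_measurable iug.
    by apply: intbleD => //; exact: intble_cst.
  by move=> w; rewrite -[N * _ * _]mulrA; exact: (stein_approx hH gN b0).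
rewrite ExD// ?Ex_cst ?ExZ//; last exact: intble_cst.
by rewrite lerD2r ler_wpM2l// mulr_ge0// sqr_ge0.
Qed.
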